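(* There is an absolute constant $C>0$ such that for every $n\ge 3$ and every set $S$ of $n$ points in the plane $\mathbb{R}^2$, the number of triangles with all three vertices in $S$ and area exactly $1$ is at most $C\, n^{44/19}$ (note $n^{44/19}=n^{2+6/19}$).
   Context: A triangle spanned by $S$ is an unordered triple of points of $S$; triangles are counted as such triples. *)

(* Defs.v *)
From HB Require Import structures.
From mathcomp Require Export all_boot all_order all_algebra.
From mathcomp Require Export finmap.
From mathcomp Require Export boolp reals exp.

Set Implicit Arguments.
Unset Strict Implicit.
Unset Printing Implicit Defensive.

Import Order.TTheory GRing.Theory Num.Theory.
Local Open Scope fset_scope.
Local Open Scope ring_scope.

(* Euclidean area of the triangle p q r, by the shoelace formula. *)
Definition triangle_area (R : realType) (p q r : R * R) : R :=
  `|(q.1 - p.1) * (r.2 - p.2) - (r.1 - p.1) * (q.2 - p.2)| / 2.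

Definition triangles (R : realType) (S : {fset R * R}) : {fset {fset R * R}} :=
  [fset T in fpowerset S | #|` T| == 3%N].

(* The vertices may be enumerated in any order: triangle_area is symmetric. *)
Definition has_area (R : realType) (a : R) (T : {fset R * R}) : Prop :=
  exists p q r : R * R, T = [fset p; q; r] /\ triangle_area p q r = a.

Definition unit_area_triangles (R : realType) (S : {fset R * R}) :
    {fset {fset R * R}} :=
  [fset T in triangles S | `[< has_area 1 T >]].

(* Main.v *)
Require Import Defs.
From mathcomp Require Import topology normedtype realfun.
From mathcomp Require Import ring lra zify.

(** Following Dumitrescu, Sharir and Toth, shear the plane so that all abscissae
are distinct and let [k] be about [n^(6/19)].  Through each vertex of a triangle
draw the parallel to the opposite side (a top line).  For a given side, the third
vertices of the unit-area triangles lie on two parallels to it, so there are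
[O(n^2 k)] unit-area triangles having a top line with fewer than [k] points.  In
the other triangles the three top lines are [k]-rich; by the Szemeredi-Trotter
theorem there are [O(n^2/k^3)] such lines, with [O(n^2/k^2)] incidences.  If
[l], [m] are the top lines at two vertices, the third vertex lies on a hyperbola
with asymptotes [l], [m] and its top line is the tangent there.  So these
triangles are incidences between [O(n^4/k^6)] hyperbolas and [O(n^2/k^2)] flags
(point, rich line).  Two flags determine the hyperbola, hence a
Szemeredi-Trotter bound applies and yields [O(n^2 k)] again.

Both incidence bounds come from one statement on graphs of continuous functions
with boundedly many pairwise crossings, and labelled points any two of which
determine the curve.  It is proved by decomposing the plane into the vertical
trapezoids of a random sample of [r] of the [N] curves: by backward analysis a
point has on average [O(N/r)] curves entering its cell, and a curve meets on
average [O(r)] cells; Cauchy-Schwarz is then applied in each cell. *)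

Set Implicit Arguments.
Unset Strict Implicit.
Unset Printing Implicit Defensive.

Import Order.TTheory GRing.Theory Num.Theory.
Import numFieldNormedType.Exports.

(** * Double counting *)

Lemma card_setU_leq (T : finType) (A B : {set T}) m n :
  #|A| <= m -> #|B| <= n -> #|A :|: B| <= m + n.
Proof. by move=> hA hB; rewrite (leq_trans (leq_card_setU _ _)) // leq_add. Qed.

Lemma size_flatten_map_leq (T : Type) (U : eqType) (m : nat) (f : U -> seq T)
    (u : seq U) :
  (forall x, x \in u -> size (f x) <= m) ->
  size (flatten [seq f x | x <- u]) <= m * size u.
Proof.
elim: u => [|x u IH] H; first by rewrite muln0.
rewrite /= size_cat mulnS leq_add //; first by apply: H; rewrite mem_head.
by apply: IH => y yu; apply: H; rewrite inE yu orbT.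
Qed.

Lemma card_fibers (T U : finType) (A : {set T}) (f : T -> U) :
  #|A| = \sum_D #|[set p in A | f p == D]|.
Proof.
rewrite -sum1_card (partition_big f predT) //=; apply: eq_bigr => D _.
by rewrite -sum1_card; apply: eq_bigl => p; rewrite inE.
Qed.

(** Exchange the summations: an ordered pair of distinct points is counted by at most one [c]. *)
Lemma sum_pairs_leq (I P : finType) (S : {set I}) (F : {set P}) (A : I -> {set P}) :
  (forall c, c \in S -> A c \subset F) ->
  (forall c d p q, c \in S -> d \in S -> p \in A c -> q \in A c -> p \in A d ->
     q \in A d -> p != q -> c = d) ->
  \sum_(c in S) #|A c| * #|A c|.-1 <= #|F| * #|F|.
Proof.
move=> AF Auniq.
have E c : c \in S -> #|A c| * #|A c|.-1 =
    \sum_(p in F) \sum_(q in F) [&& p \in A c, q \in A c & p != q].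
  move=> cS; transitivity (\sum_(p in F) (p \in A c) * #|A c|.-1).
    rewrite -big_distrl /=; congr (_ * _); rewrite -sum1_card.
    rewrite [RHS]big_mkcond [LHS]big_mkcond; apply: eq_bigr => p _.
    by have := subsetP (AF c cS) p; case: (p \in A c) => [->//|_]; case: ifP.
  apply: eq_bigr => p pF; case pA: (p \in A c); last first.
    by rewrite mul0n big1.
  rewrite mul1n (cardsD1 p) pA /= -sum1_card big_mkcond [RHS]big_mkcond /=.
  apply: eq_bigr => q _; rewrite !inE eq_sym.
  have := subsetP (AF c cS) q.
  by case: (q \in A c) => [->//|_]; [case: (p == q)|rewrite andbF; case: ifP].
rewrite (eq_bigr _ E) exchange_big /=; under eq_bigr do rewrite exchange_big /=.
apply: (@leq_trans (\sum_(p in F) \sum_(q in F) 1)); last first.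
  by rewrite !sum_nat_const muln1.
apply: leq_sum => p _; apply: leq_sum => q _.
case: (pickP [pred c | (c \in S) && [&& p \in A c, q \in A c & p != q]]).
  move=> c /= /and4P[cS pc qc pq]; rewrite (bigD1 c) //= pc qc pq big1 //.
  move=> d /andP[dS dc]; case H: [&& _, _ & _] => //; case/and3P: H => pd qd _.
  by rewrite (Auniq d c p q) ?eqxx in dc.
move=> none; rewrite big1 // => c cS.
by have := none c; rewrite /= cS /= => ->.
Qed.

(** Cauchy-Schwarz in linear form, with a free weight [t]: sum [2 * |F| * t * (a - 1) <= |F|^2 + t^2
    * a * (a - 1)] over [a = |A c|], use [sum_pairs_leq] and divide by [|F|]. *)
Lemma kst_weighted (I P : finType) (S : {set I}) (F : {set P})
    (A : I -> {set P}) (t : nat) :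
  (forall c, c \in S -> A c \subset F) ->
  (forall c d p q, c \in S -> d \in S -> p \in A c -> q \in A c -> p \in A d ->
     q \in A d -> p != q -> c = d) ->
  (forall c, c \in S -> 0 < #|A c|) ->
  2 * t * \sum_(c in S) #|A c| <= 2 * t * #|S| + #|F| * #|S| + t * t * #|F|.
Proof.
move=> AF Auniq A0.
have [F0|F0] := posnP #|F|.
  rewrite big1 ?muln0 // => c cS; have := subset_leq_card (AF c cS).
  by rewrite F0; lia.
have := sum_pairs_leq AF Auniq.
set X := \sum_(c in S) _ => XF.
have Y : 2 * t * #|F| * \sum_(c in S) #|A c|.-1
    <= #|F| * #|F| * #|S| + t * t * X.
  rewrite /X -[#|S|]sum1_card !big_distrr /= -big_split /=.
  apply: leq_sum => c cS; have := A0 c cS; case: #|A c| => // a _ /=.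
  have := nat_Cauchy #|F| (t * a); rewrite -!mulnn => h.
  apply: (@leq_trans (2 * (#|F| * (t * a)))); first by lia.
  apply: leq_trans h _; rewrite muln1 leq_add2l mulnACA leq_mul //; lia.
have Z : \sum_(c in S) #|A c| = #|S| + \sum_(c in S) #|A c|.-1.
  rewrite -[#|S|]sum1_card -big_split /=; apply: eq_bigr => c cS.
  by have := A0 c cS; lia.
rewrite Z -(leq_pmul2l F0); nia.
Qed.

(** A sample and a further curve are merged on the right into one larger sample. Backward analysis
    rests on this: the curve added last may be any member of the enlarged sample. *)
Lemma sum_draws_exchange (I : finType) (r : nat) (F : {set I} -> I -> nat) :
  \sum_(C : {set I} | #|C| == r) \sum_(c | c \notin C) F C c =
  \sum_(C : {set I} | #|C| == r.+1) \sum_(c in C) F (C :\ c) c.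
Proof.
rewrite !pair_big_dep /=.
rewrite (reindex_onto (fun x => (x.1 :\ x.2, x.2)) (fun x => (x.2 |: x.1, x.2))) /=.
  apply: eq_big => [[C c]|[C c] //] /=.
  rewrite !inE eqxx /= andbT; case cC: (c \in C).
    by rewrite (cardsD1 c C) cC add1n eqSS setD1K // eqxx !andbT.
  rewrite andbF; apply/negP => /andP[_ /eqP[e]].
  by have : c \in C; [rewrite -e !inE eqxx|rewrite cC].
by move=> [C c] /= /andP[_ cC]; rewrite setU1K.
Qed.

Lemma sum_draws_notin (I : finType) (r : nat) (F : I -> nat) :
  \sum_(C : {set I} | #|C| == r) \sum_(c | c \notin C) F c =
  'C(#|I|.-1, r) * \sum_c F c.
Proof.
rewrite (exchange_big_dep predT) //= big_distrr /=; apply: eq_bigr => c _.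
rewrite sum_nat_const; congr (_ * _).
transitivity #|[set C : {set I} | C \subset [set~ c] & #|C| == r]|.
  by rewrite -sum1_card -[RHS]sum1_card; apply: eq_bigl => C;
    rewrite inE subsetC sub1set !inE andbC.
by rewrite cards_draws cardsC1.
Qed.

(** Crude bound for few curves: a point on [d] curves has [d <= 1 + d * (d - 1)], and two curves
    share at most one point. *)
Lemma kst (I P : finType) (inc : P -> I -> bool) :
  (forall p q i j, inc p i -> inc q i -> inc p j -> inc q j -> p != q -> i = j) ->
  \sum_i #|[set p | inc p i]| <= #|P| + #|I| * #|I|.
Proof.
move=> inc_uniq.
have -> : \sum_i #|[set p | inc p i]| = \sum_p #|[set i | inc p i]|.
  under eq_bigr do rewrite -sum1dep_card; under [RHS]eq_bigr do rewrite -sum1dep_card.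
  by rewrite (exchange_big_dep predT).
have -> : #|I| * #|I| = #|[set: I]| * #|[set: I]| by rewrite cardsT.
apply: (@leq_trans (#|P| + \sum_(p in [set: P])
    #|[set i | inc p i]| * #|[set i | inc p i]|.-1)).
  rewrite -cardsT -sum1_card -big_split /=.
  rewrite (eq_bigl (fun p => p \in [set: P])); last by move=> p; rewrite inE.
  by apply: leq_sum => p _; nia.
rewrite leq_add2l; apply: sum_pairs_leq => [p _|p q i j _ _]; first exact: subsetT.
rewrite !inE => pi pj qi qj ij; apply/eqP; apply: contraT => pq.
by rewrite (inc_uniq p q i j) ?eqxx in ij.
Qed.

(** * Trapezoids of an arrangement of function graphs *)

Local Open Scope fset_scope.
Local Open Scope ring_scope.

Definition between (R : realType) (x y z : R) := (x <= z <= y) || (y <= z <= x).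

Lemma between_sym (R : realType) (x y z : R) : between x y z = between y x z.
Proof. by rewrite /between orbC. Qed.

Lemma betweenl (R : realType) (x y : R) : between x y x.
Proof. by rewrite /between !lexx !andbT /=; case: leP => // /ltW ->. Qed.

Lemma betweenr (R : realType) (x y : R) : between x y y.
Proof. by rewrite between_sym betweenl. Qed.

Lemma between_trans (R : realType) (x y z w : R) :
  between x y z -> between x z w -> between x y w.
Proof. by rewrite /between => h1 h2; apply/orP; lra. Qed.

Lemma between_split (R : realType) (x y z w : R) :
  between x z w -> between x y w \/ between y z w.
Proof.
rewrite /between; case: (leP x w); case: (leP w x); case: (leP y w);
  case: (leP w y); case: (leP w z); case: (leP z w) => //=; auto; lra.
Qed.

Lemma IVT_between (R : realType) (f : R -> R) (x y : R) :
  continuous f -> f x <= 0 -> 0 <= f y -> exists2 z, between x y z & f z = 0.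
Proof.
move=> cf fx fy.
case: (leP x y) => xy.
  have [|z] := @IVT R f x y 0 xy (continuous_subspaceT cf).
    by rewrite ge_min le_max fx fy orbT.
  by rewrite in_itv /= => zxy fz; exists z => //; rewrite /between zxy.
have [|z] := @IVT R f y x 0 (ltW xy) (continuous_subspaceT cf).
  by rewrite ge_min le_max fx fy /= orbT.
by rewrite in_itv /= => zxy fz; exists z => //; rewrite /between zxy orbT.
Qed.

Lemma min_continuous_family (R : realType) (I : eqType) (f : I -> R -> R)
    (i : I) (s : seq I) :
  (forall j, continuous (f j)) ->
  exists m : R -> R, [/\ continuous m,
    forall w j, j \in i :: s -> m w <= f j w
    & forall w, exists2 j, j \in i :: s & m w = f j w].
Proof.
move=> cf; elim: s => [|k s [m [cm m_le m_ex]]].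
  exists (f i); split => // [w j|w]; first by rewrite inE => /eqP->.
  by exists i => //; rewrite inE.
exists (fun w => Num.min (m w) (f k w)); split => [w|w j|w].
- by apply: continuous_min; [exact: cm|exact: cf].
- rewrite !inE ge_min => /or3P[/eqP->|/eqP->|js]; last 2 first.
  + by rewrite lexx orbT.
  + by rewrite m_le // inE js orbT.
  by rewrite m_le // inE eqxx.
- have [j js mj] := m_ex w.
  rewrite minEle; case: ifP => _; [exists j|exists k] => //.
    by move: js; rewrite !inE => /orP[->|->]; rewrite ?orbT.
  by rewrite !inE eqxx orbT.
Qed.

Section Cells.
Variables (R : realType) (I P : finType) (px : P -> R).
Implicit Types (g : I -> R -> R) (py : P -> R) (C : {set I}) (p q : P).

Definition above g py C p := [set h in C | py p < g h (px p)].

Definition lowest g py C p (a : I) :=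
  a \in above g py C p /\
  forall h, h \in above g py C p -> g a (px p) <= g h (px p).

(* The curve of [C] directly above [p] stays directly above on the whole
   vertical strip between [p] and [q]. *)
Definition ceiling g py C p q :=
  above g py C p = above g py C q /\
  forall a h z, lowest g py C p a -> h \in above g py C p -> h != a ->
    between (px p) (px q) z -> g a z < g h z.

Lemma lowest_ex g py C p h : h \in above g py C p ->
  exists a, lowest g py C p a.
Proof.
move=> hU; case: (arg_minP (fun a => g a (px p)) hU) => a aU a_min.
by exists a; split => // k kU; exact: a_min.
Qed.

Lemma lowest_set g py C p :
  exists A : {set I}, (#|A| <= 1)%N /\
    forall h, h \in above g py C p -> exists2 a, a \in A & lowest g py C p a.
Proof.
have [e|[h hU]] := set_0Vmem (above g py C p).
  by exists set0; rewrite cards0; split=> // h; rewrite e inE.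
have [a La] := lowest_ex hU.
by exists [set a]; rewrite cards1; split=> // _ _; exists a => //; rewrite inE.
Qed.

Lemma ceiling_lowest g py C p q a :
  ceiling g py C p q -> lowest g py C q a -> lowest g py C p a.
Proof.
case=> U_eq C_pq [aU a_min].
have [b [bU b_min]] : exists b, lowest g py C p b.
  by apply: (@lowest_ex _ _ _ _ a); rewrite U_eq.
have [->|ab] := eqVneq a b; first by [].
have := C_pq b a (px q) (conj bU b_min); rewrite U_eq aU ab betweenr.
move=> /(_ isT isT isT); rewrite ltNge a_min //.
by rewrite -U_eq.
Qed.

Lemma ceiling_sym g py C p q : ceiling g py C p q -> ceiling g py C q p.
Proof.
move=> C_pq; split; first by case: C_pq.
move=> a h z /(ceiling_lowest C_pq) La; rewrite between_sym -(proj1 C_pq).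
exact: (proj2 C_pq).
Qed.

Lemma ceiling_trans g py C p q w :
  ceiling g py C p q -> ceiling g py C q w -> ceiling g py C p w.
Proof.
move=> C_pq C_qw; split; first by rewrite (proj1 C_pq) (proj1 C_qw).
move=> a h z La hU ha /(@between_split _ _ (px q)) [|] bz.
  exact: (proj2 C_pq).
apply: (proj2 C_qw) => //; last by rewrite -(proj1 C_pq).
exact: ceiling_lowest (ceiling_sym C_pq) La.
Qed.

(* If [c1] and [c2] both enter the cell of [p], then, seen from [p], neither
   can enter before the other: [p q1] is a cell for a family containing [c2],
   whose lowest curve [a] above [p] must stay below [c2] all the way. *)
Lemma ceiling_conflict g py C p q1 q2 a c1 c2 :
  lowest g py C p a -> a != c1 -> a != c2 -> c1 != c2 -> c2 \in above g py C p ->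
  g c2 (px q2) = py q2 ->
  ceiling g py (C :\ c1) p q1 -> ceiling g py (C :\ c2) p q2 ->
  between (px p) (px q1) (px q2) -> False.
Proof.
move=> [aU a_min] ac1 ac2 c12 c2U c2q [_ C1] [U2 _] bw.
move: (aU) (c2U); rewrite !inE => /andP[aC pa] /andP[c2C pc2].
have : a \in above g py (C :\ c2) p by rewrite !inE ac2 aC.
rewrite U2 !inE => /andP[_]; apply/negP; rewrite -leNgt -c2q ltW //.
apply: C1 => //; last 2 first.
- by rewrite !inE eq_sym c12 c2C.
- by rewrite eq_sym.
split; first by rewrite !inE ac1 aC.
move=> h; rewrite !inE => /andP[/andP[_ hC] ph].
by apply: a_min; rewrite inE hC.
Qed.

(* No curve of [C] meets the vertical segment from [c] up to [a] at abscissa [z],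
   except at its top. *)
Definition visible g C (c a : I) (z : R) :=
  (g c z < g a z) && [forall h in C, ~~ (g c z <= g h z < g a z)].

(** Of two such curves, one that is at least as high as the other at [z] blocks the segment from the
    other up to [a]. *)
Lemma visible_uniq g C c1 c2 a z : c1 \in C -> c2 \in C ->
  visible g (C :\ c1) c1 a z -> visible g (C :\ c2) c2 a z -> c1 = c2.
Proof.
move=> c1C c2C /andP[lt1 /forall_inP v1] /andP[lt2 /forall_inP v2].
apply/eqP/negPn/negP => ne.
have := v1 c2; have := v2 c1; rewrite !inE ne eq_sym ne c1C c2C.
move=> /(_ isT) + /(_ isT); rewrite lt1 lt2 !andbT -!ltNge => h1 h2.
by have := lt_trans h1 h2; rewrite ltxx.
Qed.

Lemma above_const g py C c p q :
  (forall i, continuous (g i)) ->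
  g c (px p) = py p ->
  (forall h z, h \in C -> between (px p) (px q) z -> g h z != g c z) ->
  forall h z, h \in C -> between (px p) (px q) z ->
    (g c z < g h z) = (h \in above g py C p).
Proof.
move=> cg cp no1 h z hC bz; rewrite inE hC /= -cp.
have cd : continuous (fun w => g h w - g c w).
  by move=> w; apply: continuousB; exact: cg.
have cd' : continuous (fun w => g c w - g h w).
  by move=> w; apply: continuousB; exact: cg.
apply/idP/idP => lt; rewrite ltNge; apply/negP => le.
  have [||w bw w0] := @IVT_between _ _ (px p) z cd; [lra|lra|].
  have := no1 h w hC (between_trans bz bw).
  by move/eqP; apply; lra.
have [||w bw w0] := @IVT_between _ _ (px p) z cd'; [lra|lra|].
have := no1 h w hC (between_trans bz bw).
by move/eqP; apply; lra.
Qed.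

(** Suppose some [h] reaches [a] or goes below it. Then the lower envelope of the curves above [p]
    other than [a] meets [a] at some [w] of the strip. There [a] meets a curve of [C] and no curve
    of [C] lies between [c] and [a], so the crossing is visible from [c]. *)
Lemma no_event_ceiling g py C c p q :
  (forall i, continuous (g i)) ->
  g c (px p) = py p -> g c (px q) = py q ->
  (forall h z, h \in C -> between (px p) (px q) z -> g h z != g c z) ->
  (forall a h z, a \in C -> h \in C -> h != a -> between (px p) (px q) z ->
     g a z = g h z -> ~~ visible g C c a z) ->
  ceiling g py C p q.
Proof.
move=> cg cp cq no1 no2.
have side := above_const cg cp no1.
split.
  apply/setP => h; case hC: (h \in C); last by rewrite !inE hC.
  by rewrite -(side h (px q)) ?betweenr // inE hC /= -cq.
move=> a h z [aU a_min] hU ha bz; rewrite ltNge; apply/negP => le.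
pose s := enum (above g py C p :\ a).
have [m [cm m_le m_ex]] := @min_continuous_family _ _ g h s cg.
have sU j : j \in h :: s -> j \in above g py C p /\ j != a.
  rewrite inE => /orP[/eqP->//|]; rewrite mem_enum => js.
  by move: js; rewrite in_setD1 => /andP[].
have cd : continuous (fun w => g a w - m w).
  by move=> w; apply: continuousB; [exact: cg|exact: cm].
have [||w bw w0] := @IVT_between _ _ (px p) z cd.
- have [j js ->] := m_ex (px p); rewrite subr_le0 a_min //.
  by case: (sU _ js).
- rewrite subr_ge0 (le_trans _ le) // m_le // inE eqxx //.
have bw' := between_trans bz bw.
have aC : a \in C by move: aU; rewrite inE => /andP[].
have [j js mj] := m_ex w.
have [jU ja] := sU _ js.
have := no2 a j w aC _ ja bw' _.
rewrite -mj => /(_ _ _)/negP; apply.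
- by move: jU; rewrite inE => /andP[].
- lra.
rewrite /visible side ?aU //=; apply/forall_inP => k kC; apply/negP.
move=> /andP[ck ka].
have kU : k \in above g py C p.
  by rewrite -(side k w) // lt_neqAle ck eq_sym no1.
have : m w <= g k w.
  apply: m_le; rewrite inE; apply/orP; right.
  rewrite mem_enum in_setD1 kU andbT.
  by apply: contraTneq ka => ->; rewrite ltxx.
by move: ka w0; lra.
Qed.

End Cells.

(** * The incidence bound *)

Section Incidences.
Variables (R : realType) (I P : finType) (g : I -> R -> R) (px py : P -> R).
Variables (inc : P -> I -> bool) (s : nat) (crossings : I -> I -> seq R).

Hypothesis g_cont : forall i, continuous (g i).
Hypothesis inc_on : forall p i, inc p i -> g i (px p) = py p.
Hypothesis inc_px : forall p q i, inc p i -> inc q i -> px p = px q -> p = q.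
Hypothesis inc_uniq : forall p q i j, inc p i -> inc q i -> inc p j -> inc q j ->
  p != q -> i = j.
Hypothesis crossings_size : forall i j, (size (crossings i j) <= s)%N.
Hypothesis crossingsP : forall i j z, i != j -> g i z = g j z -> z \in crossings i j.

Implicit Types (C : {set I}) (p q : P) (c : I).

(** Reflection in the horizontal axis: the floor of a trapezoid is the ceiling of the reflected
    one. *)
Let gN (i : I) (z : R) := - g i z.
Let pyN (p : P) := - py p.

Definition off C p := [forall h in C, g h (px p) != py p].

(* [p] and [q] lie in the same trapezoid of the vertical decomposition of [C]. *)
Definition same_cell C p q :=
  (p == q) || `[< ceiling px g py C p q /\ ceiling px gN pyN C p q >].

(** This rests on the disjunct [p == q]: [ceiling] fails from [p] to itself when two curves of [C]
    tie for lowest above [p]. *)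
Lemma same_cell_refl C : reflexive (same_cell C).
Proof. by move=> p; rewrite /same_cell eqxx. Qed.

Lemma same_cell_sym C : symmetric (same_cell C).
Proof.
suff H p q : same_cell C p q -> same_cell C q p.
  by move=> p q; apply/idP/idP; exact: H.
case/orP => [/eqP->|/asboolP[h1 h2]]; first exact: same_cell_refl.
by apply/orP; right; apply/asboolP; split; exact: ceiling_sym.
Qed.

Lemma same_cell_trans C : transitive (same_cell C).
Proof.
move=> q p w /orP[/eqP->//|/asboolP[h1 h2]] /orP[/eqP<-|/asboolP[h3 h4]].
  by apply/orP; right; apply/asboolP.
apply/orP; right; apply/asboolP; split.
  exact: ceiling_trans h1 h3.
exact: ceiling_trans h2 h4.
Qed.

Lemma same_cell_equiv C : {in [set: P] & &, equivalence_rel (same_cell C)}.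
Proof.
move=> p q w _ _ _; split; first exact: same_cell_refl.
move=> pq; apply/idP/idP => [pw|qw]; last exact: same_cell_trans qw.
by apply: same_cell_trans pw; rewrite same_cell_sym.
Qed.

Definition enters C p c :=
  [exists q, [&& inc q c, off C q & same_cell C p q]].

(* Backward analysis: [c] is the curve above or below [p], or the first one to
   enter the cell of [p] from the left or from the right. *)
Lemma card_enters C p :
  (#|[set c in C | off (C :\ c) p && enters (C :\ c) p c]| <= 4)%N.
Proof.
set D := [set c in C | _].
(* If [p] lies on a curve of [C], only the removal of that curve can free [p]. *)
case offp: (off C p); last first.
  move/negbT: offp; rewrite negb_forall_in => /exists_inP[h hC /negPn/eqP hp].
  apply: (@leq_trans 1) => //; rewrite -(cards1 h); apply/subset_leq_card/subsetP.
  move=> c; rewrite !inE => /and3P[cC /forall_inP offc _].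
  apply: contraT => ch; have := offc h; rewrite !inE eq_sym ch hC hp eqxx.
  by move=> /(_ isT).
move/forall_inP: offp => offp.
have [A [A1 LA]] := lowest_set px g py C p.
have [B [B1 LB]] := lowest_set px gN pyN C p.
pose side (b : bool) := [set c in D :\: (A :|: B) |
  [exists q, [&& inc q c, same_cell (C :\ c) p q &
     if b then px q <= px p else px p <= px q]]].
have side1 b : (#|side b| <= 1)%N.
  (* Of two curves entering on the same side, let [q2] be no further from [p] than [q1];
     [ceiling_conflict] excludes this unless the curves coincide. *)
  suff H c1 c2 q1 q2 : c1 \in side b -> c2 \in side b ->
      [&& inc q1 c1, same_cell (C :\ c1) p q1 &
        if b then px q1 <= px p else px p <= px q1] ->
      [&& inc q2 c2, same_cell (C :\ c2) p q2 &
        if b then px q2 <= px p else px p <= px q2] ->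
      between (px p) (px q1) (px q2) -> c1 = c2.
    apply/card_le1_eqP => c1 c2 c1s c2s; move: (c1s) (c2s); rewrite !(inE, in_setD).
    move=> /andP[_ /existsP[q1 h1]] /andP[_ /existsP[q2 h2]].
    have [bw|bw] : between (px p) (px q1) (px q2) \/
        between (px p) (px q2) (px q1).
      case/and3P: h1 => _ _; case/and3P: h2 => _ _; rewrite /between.
      case: (b) => l1 l2; rewrite l1 l2 /= ?andbT;
        case: (leP (px q1) (px q2)) => [|/ltW] e; rewrite ?e ?orbT; auto.
    - by apply/esym; exact: (H c1 c2 q1 q2).
    - exact: (H c2 c1 q2 q1).
  rewrite !(inE, in_setD) negb_or.
  move=> /andP[/andP[/andP[nA1 nB1] /and3P[C1 _ _]] _].
  rewrite negb_or => /andP[/andP[/andP[nA2 nB2] /and3P[C2 _ _]] _].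
  move=> /and3P[i1 e1 _] /and3P[i2 e2 _] bw.
  have ne c q : c \in C -> inc q c -> p != q.
    by move=> cC iq; apply: contraNneq (offp _ cC) => ->; rewrite inc_on.
  move: e1 e2; rewrite /same_cell (negPf (ne _ _ C1 i1)) (negPf (ne _ _ C2 i2)) /=.
  move=> /asboolP[u1 d1] /asboolP[u2 d2].
  apply/eqP; apply: contraT => c12.
  have notin (Z : {set I}) a c : a \in Z -> c \notin Z -> a != c.
    by move=> aZ; apply: contraNneq => <-.
  have := offp _ C2; rewrite neq_lt => /orP[lt|lt].
    have c2U : c2 \in above px gN pyN C p by rewrite inE C2 /= /gN /pyN ltrN2.
    have [a aB La] := LB _ c2U.
    by case: (@ceiling_conflict _ _ _ px gN pyN C p q1 q2 a c1 c2) => //;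
      [exact: notin nB1|exact: notin nB2|rewrite /gN /pyN inc_on].
  have c2U : c2 \in above px g py C p by rewrite inE C2.
  have [a aA La] := LA _ c2U.
  by case: (@ceiling_conflict _ _ _ px g py C p q1 q2 a c1 c2) => //;
    [exact: notin nA1|exact: notin nA2|rewrite inc_on].
have DS : D \subset (A :|: B) :|: (side true :|: side false).
  apply/subsetP => c cD; rewrite inE; case cAB: (c \in A :|: B) => //=.
  have := cD; rewrite inE => /and3P[_ _ /existsP[q /and3P[iq _ eq]]].
  rewrite inE; apply/orP; case: (leP (px q) (px p)) => [|/ltW] le; [left|right];
    rewrite inE in_setD cAB cD /=; apply/existsP; exists q; by rewrite iq eq.
apply: leq_trans (subset_leq_card DS) _.
apply: (@card_setU_leq _ _ _ 2 2); exact: (@card_setU_leq _ _ _ 1 1).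
Qed.

(** * Events: abscissae at which a curve can change its cell *)

Definition direct_events C c := flatten [seq crossings c h | h <- enum C].

(** For [g] and [gN] these are the abscissae where the ceiling and the floor seen from [c] may pass
    from one curve of [C] to another. *)
Definition visible_events (G : I -> R -> R) C c :=
  flatten [seq [seq z <- crossings ah.1 ah.2 | visible G C c ah.1 z]
          | ah <- enum [set ah : I * I | [&& ah.1 \in C, ah.2 \in C & ah.2 != ah.1]]].

Definition events C c :=
  direct_events C c ++ visible_events g C c ++ visible_events gN C c.

Lemma no_event_same_cell C c p q : c \notin C ->
  g c (px p) = py p -> g c (px q) = py q ->
  (forall z, z \in events C c -> ~~ between (px p) (px q) z) ->
  same_cell C p q.
Proof.
move=> cC cp cq noev; apply/orP; right; apply/asboolP.
have no1 h z : h \in C -> between (px p) (px q) z -> g h z != g c z.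
  move=> hC bz; apply: contraL bz => /eqP e; apply: noev.
  rewrite /events mem_cat; apply/orP; left; apply/flattenP.
  exists (crossings c h); first by apply: map_f; rewrite mem_enum.
  by apply: crossingsP => //; apply: contraNneq cC => ->.
have vis G a h z : a \in C -> h \in C -> h != a -> g a z = g h z ->
    visible G C c a z -> z \in visible_events G C c.
  move=> aC hC ha e v; apply/flattenP.
  exists [seq z <- crossings a h | visible G C c a z].
    by apply/mapP; exists (a, h) => //=; rewrite mem_enum inE /= aC hC.
  by rewrite mem_filter v crossingsP // eq_sym.
split.
  apply: (@no_event_ceiling _ _ _ px g py C c) => // a h z aC hC ha bz e.
  apply: contraL bz => v; apply: noev; rewrite /events !mem_cat.
  by rewrite (vis g a h) ?orbT.
apply: (@no_event_ceiling _ _ _ px gN pyN C c) => //.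
- by move=> i z; apply: continuousN; exact: g_cont.
- by rewrite /gN /pyN cp.
- by rewrite /gN /pyN cq.
- by move=> h z hC bz; rewrite /gN eqr_opp no1.
move=> a h z aC hC ha bz /oppr_inj e.
apply: contraL bz => v; apply: noev; rewrite /events !mem_cat.
by rewrite (vis gN a h) ?orbT.
Qed.

Definition on_curve C c := [set p | inc p c & off C p].

Lemma card_cells_on C c : c \notin C ->
  (#|[set [set q | same_cell C p q] | p in on_curve C c]|
    <= 2 * size (events C c) + 1)%N.
Proof.
move=> cC; set E := events C c; set K := [set _ | p in _].
(* The cell of [p] is determined by its rank among the events, where an event
   at abscissa [px p] counts one half. *)
pose m p := (count (fun z : R => (z < px p)%R) E
  + count (fun z : R => (z <= px p)%R) E)%N.
have m_lt p : (m p < (2 * size E + 1).-1.+1)%N.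
  by rewrite addn1 /= ltnS mul2n -addnn leq_add ?count_size.
have m_inj p q : p \in on_curve C c -> q \in on_curve C c -> m p = m q ->
    same_cell C p q.
  wlog le : p q / px p <= px q.
    move=> H pc qc e; case: (leP (px p) (px q)) => [|/ltW] le; first exact: H.
    by rewrite same_cell_sym; exact: H.
  rewrite !inE => /andP[ip _] /andP[iq _] e.
  move: le; rewrite le_eqVlt => /orP[/eqP|] le.
    by rewrite (inc_px ip iq le) same_cell_refl.
  apply: (@no_event_same_cell C c); rewrite ?inc_on // => z zE.
  have l1 : (count (fun z : R => (z < px p)%R) E <= count (fun z : R => (z < px q)%R) E)%N.
    by apply: sub_count => w /= h; lra.
  have l2 : (count (fun z : R => (z <= px p)%R) E <= count (fun z : R => (z <= px q)%R) E)%N.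
    by apply: sub_count => w /= h; lra.
  have e1 : (count (fun z : R => (z < px p)%R) E = count (fun z : R => (z < px q)%R) E)%N.
    by move: e l1 l2; rewrite /m; lia.
  have e2 : (count (fun z : R => (z <= px p)%R) E = count (fun z : R => (z <= px q)%R) E)%N.
    by move: e l1 l2; rewrite /m; lia.
  (* Nested predicates with equal counts agree on [E]. An event [z] of the closed strip would thus
     satisfy first [z <= px p], then [z < px p], against [px p <= z]. *)
  have strict (a b : pred R) : (forall w, a w -> b w) ->
      (count a E = count b E)%N -> b z -> a z.
    move=> ab cnt bz; apply: contraT => naz.
    suff : (count a E < count b E)%N by rewrite cnt ltnn.
    rewrite -[X in (_ < X)%N]size_filter -(count_predC a [seq w <- E | b w]).
    rewrite !count_filter -addn1 leq_add //.
      by apply: sub_count => w /= aw; rewrite aw ab.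
    by rewrite -has_count; apply/hasP; exists z => //=; rewrite bz naz.
  apply/negP => bz.
  have zpq : px p <= z <= px q by move: bz le; rewrite /between => /orP[]; lra.
  have zp : z <= px p.
    by apply: (strict (fun z => z <= px p) (fun z => z <= px q)) => // [w|]; lra.
  have : z < px p; last by lra.
  by apply: (strict (fun z => z < px p) (fun z => z < px q)) => // [w|]; lra.
pose f (D : {set P}) : 'I_((2 * size E + 1).-1.+1) :=
  if [pick p in on_curve C c | D == [set q | same_cell C p q]] is Some p
  then Ordinal (m_lt p) else ord0.
suff f_inj : {in K &, injective f}.
  by rewrite -(card_in_imset f_inj) (leq_trans (max_card _)) // card_ord addn1.
move=> D1 D2 /imsetP[p1 p1c D1e] /imsetP[p2 p2c D2e]; rewrite /f.
case: pickP => [p /andP[pc /eqP->]|/(_ p1)]; last by rewrite D1e p1c eqxx.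
case: pickP => [q /andP[qc /eqP->]|/(_ p2)]; last by rewrite D2e p2c eqxx.
move=> [] /(m_inj _ _ pc qc) pq; apply/setP => w; rewrite !inE.
by have [_ ->] := same_cell_equiv C (in_setT p) (in_setT q) (in_setT w).
Qed.


Lemma size_direct_events C c : (size (direct_events C c) <= s * #|C|)%N.
Proof. by rewrite cardE; apply: size_flatten_map_leq. Qed.

Lemma card_on_sampled C c : c \notin C ->
  (#|[set p | inc p c & ~~ off C p]| <= s * #|C|)%N.
Proof.
move=> cC; apply: leq_trans (size_direct_events C c).
rewrite cardE -(size_map px); apply: uniq_leq_size.
  rewrite map_inj_in_uniq ?enum_uniq // => p q.
  by rewrite !mem_enum !inE => /andP[ip _] /andP[iq _]; exact: inc_px ip iq.
move=> x /mapP[p]; rewrite mem_enum inE => /andP[ip].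
rewrite negb_forall_in => /exists_inP[h hC /negPn/eqP hp] ->.
apply/flattenP; exists (crossings c h); first by apply: map_f; rewrite mem_enum.
apply: crossingsP; last by rewrite inc_on.
by apply: contraNneq cC => ->.
Qed.

(** [kst_weighted] is summed over the cells. Pairs of a curve and a cell are counted by
    [card_cells_on]; the products [|F| * |N|] are regrouped by points, each point paying for the
    curves entering its cell. *)
Lemma incidences_off C t :
  (2 * t * \sum_(c | c \notin C) #|on_curve C c| <=
   2 * t * (\sum_(c | c \notin C) (2 * size (events C c) + 1)) +
   \sum_(p | off C p) #|[set c | c \notin C & enters C p c]| + t * t * #|P|)%N.
Proof.
pose k p := [set q | same_cell C p q].
pose A c D := [set p in on_curve C c | k p == D].
pose F D := [set p | off C p & k p == D].
pose N D := [set c | (c \notin C) && (0 < #|A c D|)%N].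
have cell D : (2 * t * \sum_(c | c \notin C) #|A c D| <=
    2 * t * #|N D| + #|F D| * #|N D| + t * t * #|F D|)%N.
  have -> : (\sum_(c | c \notin C) #|A c D| = \sum_(c in N D) #|A c D|)%N.
    rewrite [RHS]big_mkcond [LHS]big_mkcond; apply: eq_bigr => c _.
    by rewrite !inE; case: (c \in C) => //=; case: ltnP => //; rewrite leqn0 => /eqP.
  apply: kst_weighted => [c _|c d p q _ _|c]; last by rewrite inE => /andP[].
    by apply/subsetP => p; rewrite !inE => /andP[/andP[_ ->] ->].
  rewrite !inE => /andP[/andP[pc _] _] /andP[/andP[qc _] _].
  by move=> /andP[/andP[pd _] _] /andP[/andP[qd _] _]; exact: (inc_uniq pc qc).
have -> : (\sum_(c | c \notin C) #|on_curve C c| =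
    \sum_D \sum_(c | c \notin C) #|A c D|)%N.
  rewrite exchange_big /=; apply: eq_bigr => c _; exact: card_fibers.
set E := (\sum_(c | _) (_ + 1))%N.
rewrite big_distrr /=; apply: leq_trans (leq_sum _ (fun D _ => cell D)) _.
rewrite !big_split /= -!big_distrr /=; apply: leq_add; first apply: leq_add.
- rewrite leq_mul2l; apply/orP; right; rewrite {}/E.
  under eq_bigr do rewrite -sum1dep_card.
  rewrite (exchange_big_dep (fun c => c \notin C)) /=; last by move=> D c _ /andP[].
  apply: leq_sum => c cC; apply: leq_trans (card_cells_on cC).
  rewrite sum1dep_card; apply/subset_leq_card/subsetP => D.
  rewrite inE => /andP[_]; rewrite card_gt0 => /set0Pn[p].
  by rewrite inE => /andP[pc /eqP<-]; apply: imset_f.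
- under eq_bigr => D _ do
    rewrite -[#|F D|]sum1dep_card big_distrl /=.
  rewrite (exchange_big_dep (off C)) /=; last by move=> D p _ /andP[].
  apply: leq_sum => p offp; under eq_bigl do rewrite offp eq_sym.
  rewrite big_pred1_eq mul1n; apply/subset_leq_card/subsetP => c.
  rewrite !inE => /andP[-> /=]; rewrite card_gt0 => /set0Pn[q].
  rewrite !inE => /andP[/andP[iq offq] /eqP kq]; apply/existsP; exists q.
  rewrite iq offq /=; have : q \in k q by rewrite inE same_cell_refl.
  by rewrite kq inE.
- rewrite leq_mul2l; apply/orP; right.
  rewrite (eq_bigr (fun D => #|[set p in [set p | off C p] | k p == D]|)).
    by rewrite -card_fibers max_card.
  by move=> D _; apply: eq_card => p; rewrite !inE.
Qed.

(** * Averages over all samples of [r] curves *)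

(** Enlarge the sample by [c]: among [r.+1] curves, a listed crossing of [a] and [h] is visible from
    at most one curve, by [visible_uniq]. *)
Lemma sum_visible_events (G : I -> R -> R) r :
  (\sum_(C : {set I} | #|C| == r) \sum_(c | c \notin C) size (visible_events G C c)
   <= 'C(#|I|, r.+1) * (s * (r.+1 * r.+1)))%N.
Proof.
rewrite sum_draws_exchange -card_draws -sum_nat_const big_mkcond [leqRHS]big_mkcond.
apply: leq_sum => C _; rewrite inE; case: eqP => // Cr.
pose Q (C : {set I}) := [set ah : I * I | [&& ah.1 \in C, ah.2 \in C & ah.2 != ah.1]].
have Esz c : size (visible_events G (C :\ c) c) =
    (\sum_(ah in Q (C :\ c)) \sum_(z <- crossings ah.1 ah.2)
        visible G (C :\ c) c ah.1 z)%N.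
  rewrite /visible_events size_flatten /shape -map_comp sumnE big_map big_enum /=.
  apply: eq_big => [ah|ah _]; first by rewrite inE.
  by rewrite size_filter -sum1_count big_mkcond; apply: eq_bigr => z _; case: ifP.
under eq_bigr do rewrite Esz.
rewrite (exchange_big_dep (mem (Q C))) /=; last first.
  by move=> c ah _; rewrite !inE => /and3P[/andP[_ ->] /andP[_ ->] ->].
apply: (@leq_trans (\sum_(ah in Q C) s)); last first.
  rewrite sum_nat_const mulnC leq_mul2l -Cr; apply/orP; right.
  rewrite -cardsX; apply/subset_leq_card/subsetP => ah.
  by rewrite !inE => /and3P[-> ->].
apply: leq_sum => ah _; rewrite exchange_big /=.
apply: leq_trans (crossings_size ah.1 ah.2); rewrite -sum1_size.
apply: leq_sum => z _.
case: (pickP [pred c | (c \in C) && visible G (C :\ c) c ah.1 z]); last first.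
  move=> none; rewrite big1 // => c /andP[cC _].
  by have := none c; rewrite /= cC /= => ->.
move=> c /= /andP[cC vc].
rewrite big_mkcond (bigD1 c) //= big1 ?addn0; first by case: ifP => // _; exact: leq_b1.
move=> d dc; case: ifP => // /andP[dC _]; case vd: (visible _ _ _ _ _) => //.
by rewrite (visible_uniq dC cC vd vc) eqxx in dc.
Qed.

Lemma sum_enters r :
  (\sum_(C : {set I} | #|C| == r)
     \sum_(p | off C p) #|[set c | c \notin C & enters C p c]|
   <= 'C(#|I|, r.+1) * (4 * #|P|))%N.
Proof.
pose e C p c : nat := off C p && enters C p c.
rewrite (eq_bigr (fun C : {set I} =>
    \sum_(c | c \notin C) \sum_p e C p c)%N); last first.
  move=> C _; rewrite exchange_big /= big_mkcond; apply: eq_bigr => p _.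
  rewrite /e; case: off => /=; last by rewrite big1.
  by rewrite -sum1dep_card big_mkcondr /=; apply: eq_bigr => c _; case: enters.
rewrite sum_draws_exchange -card_draws -sum_nat_const big_mkcond [leqRHS]big_mkcond.
apply: leq_sum => C _; rewrite inE; case: eqP => // _.
rewrite exchange_big /= mulnC -sum_nat_const; apply: leq_sum => p _.
apply: leq_trans (card_enters C p); rewrite -sum1dep_card big_mkcondr /=.
by apply: leq_sum => c _; rewrite /e; case: (_ && _).
Qed.

(** The weight [t] is at least the square root of [#|I| / r], while on average [O(#|I| / r)] curves
    enter the cell of a point; so the term of [incidences_off] with [enters] is dominated by the
    order of the one with [t * t]. *)
Theorem incidences_leq (r t : nat) :
  (0 < s -> 0 < r -> 0 < t -> #|I| <= r * (t * t) ->
  \sum_i #|[set p | inc p i]| <= 12 * s * (#|I| * r) + 3 * (#|P| * t))%N.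
Proof.
move=> s0 r0 t0 Nrt; set N := #|I|; set T := (\sum_i _)%N.
(* With fewer than [2 * r] curves the crude bound is enough, as [N * N <= 2 * N * r]. *)
have [Nr|Nr] := ltnP N (2 * r).
  have : (T <= #|P| + N * N)%N by exact: kst.
  have h1 : (N * N <= N * r * 2)%N by rewrite -mulnA leq_mul2l; lia.
  have h2 : (N * r * 2 <= 12 * s * (N * r))%N by rewrite mulnC leq_mul2r; lia.
  have h3 : (#|P| * 1 <= #|P| * t)%N by rewrite leq_mul2l t0 orbT.
  lia.
have key (C : {set I}) : #|C| = r ->
    (2 * t * \sum_(c | c \notin C) #|[set p | inc p c]| <=
     2 * t * \sum_(c | c \notin C) (3 * s * r + 1) +
     4 * t * (\sum_(c | c \notin C) size (visible_events g C c)) +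
     4 * t * (\sum_(c | c \notin C) size (visible_events gN C c)) +
     \sum_(p | off C p) #|[set c | c \notin C & enters C p c]| + t * t * #|P|)%N.
  move=> Cr; have := incidences_off C t.
  set X := (\sum_(p | _) _)%N => H.
  have H1 : (\sum_(c | c \notin C) #|[set p | inc p c]| <=
      \sum_(c | c \notin C) #|on_curve C c| + \sum_(c | c \notin C) s * r)%N.
    rewrite -big_split /=; apply: leq_sum => c cC.
    rewrite -Cr; apply: leq_trans (leq_add (leqnn _) (card_on_sampled cC)).
    apply: leq_trans (leq_card_setU _ _); apply/subset_leq_card/subsetP => p.
    by rewrite !inE => ->; case: off.
  have H2 : (\sum_(c | c \notin C) (2 * size (events C c) + 1) <=
      \sum_(c | c \notin C) (2 * s * r + 1) +
      2 * (\sum_(c | c \notin C) size (visible_events g C c)) +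
      2 * (\sum_(c | c \notin C) size (visible_events gN C c)))%N.
    rewrite 2!big_distrr -!big_split /=; apply: leq_sum => c cC.
    rewrite /events !size_cat; have := size_direct_events C c; rewrite Cr; lia.
  have H3 : (\sum_(c | c \notin C) (3 * s * r + 1) =
      \sum_(c | c \notin C) (2 * s * r + 1) + \sum_(c | c \notin C) s * r)%N.
    by rewrite -big_split /=; apply: eq_bigr => c _; lia.
  have H1' := leq_mul (leqnn (2 * t)) H1; have H2' := leq_mul (leqnn (2 * t)) H2.
  rewrite H3; lia.
have tot : (2 * t * ('C(N.-1, r) * T) <=
   2 * t * ('C(N.-1, r) * (N * (3 * s * r + 1))) +
   8 * t * ('C(N, r.+1) * (s * (r.+1 * r.+1))) +
   'C(N, r.+1) * (4 * #|P|) + 'C(N, r) * (t * t * #|P|))%N.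
  have E1 : (\sum_(C : {set I} | #|C| == r) t * t * #|P| = 'C(N, r) * (t * t * #|P|))%N.
    by rewrite sum_nat_cond_const card_draws.
  rewrite -E1 -sum_draws_notin -[(N * _)%N]sum_nat_const -sum_draws_notin.
  have V1 := sum_visible_events g r; have V2 := sum_visible_events gN r.
  have V3 := sum_enters r.
  apply: (@leq_trans (\sum_(C : {set I} | #|C| == r)
    (2 * t * \sum_(c | c \notin C) (3 * s * r + 1) +
     4 * t * (\sum_(c | c \notin C) size (visible_events g C c)) +
     4 * t * (\sum_(c | c \notin C) size (visible_events gN C c)) +
     \sum_(p | off C p) #|[set c | c \notin C & enters C p c]| + t * t * #|P|))%N).
    by rewrite big_distrr; apply: leq_sum => C /eqP /key.
  move: (3 * s * r + 1)%N (t * t * #|P|)%N => K1 K2.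
  rewrite !big_split /= -!big_distrr /=; have V1' := leq_mul (leqnn (4 * t)) V1.
  have V2' := leq_mul (leqnn (4 * t)) V2; rewrite leq_add2r; apply: leq_add V3.
  rewrite -addnA leq_add2l; apply: leq_trans (leq_add V1' V2') _.
  by rewrite -mulnDl; apply: eq_leq; congr (_ * _)%N; lia.
set B := 'C(N, r) in tot; set B' := 'C(N, r.+1) in tot; set B1 := 'C(N.-1, r) in tot.
(* All binomial coefficients are compared with [M = (N - r) * B]: [N * B1 = M], [r.+1 * B' = M], and
   [N * B <= 2 * M] because [2 * r <= N]. *)
have E1 : (N * B1 = (N - r) * B)%N by exact: mul_bin_down.
have E2 : (r.+1 * B' = (N - r) * B)%N by exact: mul_bin_left.
set M := ((N - r) * B)%N in E1 E2.
have M0 : (0 < M)%N by rewrite muln_gt0 bin_gt0; lia.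
have NB' : (N * B' <= t * t * M)%N.
  by rewrite -E2 mulnA leq_mul2r; apply/orP; right; nia.
have NB : (N * B <= 2 * M)%N by rewrite /M mulnA leq_mul2r; apply/orP; right; lia.
have tot' := leq_mul (leqnn N) tot.
have : (2 * t * M * T <= 2 * t * M * (12 * s * (N * r) + 3 * (#|P| * t)))%N; last first.
  by rewrite leq_pmul2l // muln_gt0 M0 muln_gt0 t0.
apply: (@leq_trans (2 * t * M * (N * (3 * s * r + 1)) +
   8 * t * N * (s * r.+1) * M + 4 * #|P| * (N * B') + t * t * #|P| * (N * B))%N).
  have e1 : (8 * t * N * (s * r.+1) * M =
      N * (8 * t * (B' * (s * (r.+1 * r.+1)))))%N by rewrite -E2; ring.
  rewrite e1 -E1; lia.
have p1 := leq_mul (leqnn (4 * #|P|)) NB'.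
have p2 := leq_mul (leqnn (t * t * #|P|)) NB.
have p3 : (2 * t * M * (N * (3 * s * r + 1)) + 8 * t * N * (s * r.+1) * M <=
    2 * t * M * (12 * s * (N * r)))%N.
  have -> : (2 * t * M * (N * (3 * s * r + 1)) + 8 * t * N * (s * r.+1) * M =
     2 * t * M * (N * (3 * s * r + 1 + 4 * s * r.+1)))%N by ring.
  rewrite leq_mul2l; apply/orP; right.
  have -> : (12 * s * (N * r) = N * (12 * s * r))%N by ring.
  rewrite leq_mul2l; apply/orP; right; nia.
lia.
Qed.

End Incidences.

(** With [t] near the square root of [#|I| / r] and [r] near [#|P|^(2/3) / #|I|^(1/3)], both terms
    have the Szemeredi-Trotter order [(#|P| * #|I|)^(2/3)]; keeping [r] and [t] free avoids
    roots. *)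
Theorem incidence_bound (R : realType) (I P : finType) (g : I -> R -> R)
    (px py : P -> R) (inc : P -> I -> bool) (s : nat) :
  (forall i, continuous (g i)) ->
  (forall p i, inc p i -> g i (px p) = py p) ->
  (forall p q i, inc p i -> inc q i -> px p = px q -> p = q) ->
  (forall p q i j, inc p i -> inc q i -> inc p j -> inc q j -> p != q -> i = j) ->
  (forall i j, i != j -> exists2 zs : seq R, (size zs <= s)%N &
     forall z, g i z = g j z -> z \in zs) ->
  forall r t, (0 < s -> 0 < r -> 0 < t -> #|I| <= r * (t * t) ->
    \sum_i #|[set p | inc p i]| <= 12 * s * (#|I| * r) + 3 * (#|P| * t))%N.
Proof.
move=> cg on_g px_inj uniq_g cross r t.
have /choice[cr crP] (ij : I * I) : exists zs : seq R, (size zs <= s)%N /\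
    (ij.1 != ij.2 -> forall z, g ij.1 z = g ij.2 z -> z \in zs).
  have [->|ne] := eqVneq ij.1 ij.2; first by exists [::].
  by have [zs zs_s zsP] := cross _ _ ne; exists zs.
apply: (@incidences_leq R I P g px py inc s (fun i j => cr (i, j))) => //.
  by move=> i j; case: (crP (i, j)).
by move=> i j z ne; case: (crP (i, j)) => _ /(_ ne z).
Qed.

(** * Rich lines *)

Definition on_line (R : realType) (x y : R) (l : R * R) := y == l.1 * x + l.2.

Lemma affine_continuous (R : realType) (a b : R) : continuous (fun x : R => a * x + b).
Proof.
move=> x; apply: continuousD; last exact: cst_continuous.
by apply: continuousM; [exact: cst_continuous|exact: id].
Qed.

Section Lines.
Variables (R : realType) (P : finType) (X Y : P -> R).
Hypothesis X_inj : injective X.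

Lemma line_uniq (p q : P) (l m : R * R) : p != q ->
  on_line (X p) (Y p) l -> on_line (X q) (Y q) l ->
  on_line (X p) (Y p) m -> on_line (X q) (Y q) m -> l = m.
Proof.
move=> pq /eqP pl /eqP ql /eqP pm /eqP qm.
have Xpq : X p - X q != 0 by rewrite subr_eq0 (inj_eq X_inj).
have e : l.1 = m.1 by apply: (mulIf Xpq); lra.
have e2 : l.2 = m.2 by move: pl pm; rewrite e; lra.
by rewrite (surjective_pairing l) e e2 -surjective_pairing.
Qed.

Variable L : {fset R * R}.

Definition line_points (l : L) := [set p | on_line (X p) (Y p) (val l)].

Lemma line_incidences (r t : nat) :
  (0 < r -> 0 < t -> #|` L| <= r * (t * t) ->
   \sum_(l : L) #|line_points l| <= 12 * (#|` L| * r) + 3 * (#|P| * t))%N.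
Proof.
move=> r0 t0; rewrite cardfE => Lrt.
apply: (@incidence_bound R L P (fun l x => (val l).1 * x + (val l).2) X Y
  (fun p l => on_line (X p) (Y p) (val l)) 1) => //.
- by move=> l; exact: affine_continuous.
- by move=> p l /eqP.
- by move=> p q l _ _; exact: X_inj.
- by move=> p q l m pl ql pm qm pq; apply/val_inj; exact: (line_uniq pq).
(* For parallel lines the quotient takes the default value 0, which is harmless: distinct parallels
   have no common point. *)
move=> l m lm; exists [:: ((val m).2 - (val l).2) / ((val l).1 - (val m).1)] => // z.
move=> e; rewrite inE; have [e1|ne] := eqVneq (val l).1 (val m).1.
  case/eqP: lm; apply/val_inj.
  rewrite (surjective_pairing (val l)) (surjective_pairing (val m)) e1.
  by congr pair; move: e; rewrite e1; lra.
have ne' : (val l).1 - (val m).1 != 0 by rewrite subr_eq0.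
apply/eqP; apply: (mulIf ne'); rewrite mulfVK //; lra.
Qed.

Variable k : nat.
Hypothesis k_ge2 : (2 <= k)%N.
Hypothesis L_rich : forall l : L, (k <= #|line_points l|)%N.
Hypothesis k_small : (k * k <= 4 * #|P|)%N.

(** Each line has at least [k] points, so [k * N] is at most the number of incidences. With [r]
    about [k / 24], the first term of [line_incidences] takes at most half of this and
    [k * N <= 6 * n * t] remains, [t] being about the square root of [N / r]. *)
Lemma card_rich_lines : (#|` L| * k ^ 3 <= 24 * 576 * #|P| ^ 2)%N.
Proof.
set n := #|P|; set N := #|` L|.
have NI : (k * N <= \sum_(l : L) #|line_points l|)%N.
  by rewrite /N cardfE mulnC -sum_nat_const; apply: leq_sum => l _.
(* For small [k] counting pairs of points is enough, since [k ^ 3 <= 24 ^ 3 = 24 * 576]. *)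
have [k24|k24] := ltnP k 24.
  have Nn : (N * 2 <= n * n)%N.
    have : (\sum_(l in [set: L]) #|line_points l| * #|line_points l|.-1
        <= #|[set: P]| * #|[set: P]|)%N.
      apply: sum_pairs_leq => [l _|l m p q _ _]; first exact: subsetT.
      rewrite !inE => pl ql pm qm pq; apply/val_inj; exact: (line_uniq pq).
    rewrite !cardsT; apply: leq_trans.
    rewrite /N cardfE -cardsT -sum_nat_const; apply: leq_sum => l _.
    by have := L_rich l; nia.
  have k3 : (k ^ 3 <= 24 * 576)%N by rewrite (@leq_trans (24 ^ 3)%N) // leq_exp2r // ltnW.
  by rewrite mulnC leq_mul //; lia.
pose r := (k %/ 24)%N.
have r0 : (0 < r)%N by rewrite divn_gt0.
have kr : (24 * r <= k)%N by rewrite mulnC leq_divM.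
have rk : (k <= 48 * r)%N by move: (divn_eq k 24) (ltn_pmod k (isT : 0 < 24)%N); lia.
have [N0|N0] := posnP N; first by rewrite N0.
have ext : exists t, (N <= r * (t * t))%N by exists N; nia.
case: (ex_minnP ext) => t Nt t_min.
have t0 : (0 < t)%N by case: t Nt {t_min} => //; lia.
have := leq_trans NI (line_incidences r0 t0 Nt); rewrite -/n -/N => h.
have kN : (k * N <= 6 * n * t)%N by nia.
have [t1|t2] := leqP t 1.
  have {t1 t0} t1 : t = 1%N by lia.
  move: kN; rewrite t1 muln1 => kN.
  have -> : (N * k ^ 3 = (k * N) * (k * k))%N by ring.
  apply: leq_trans (leq_mul kN k_small) _.
  by rewrite -/n mulnACA -mulnn leq_mul2r orbT.
have rt : (r * (t * t) <= 4 * N)%N.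
  have lt : (r * ((t.-1) * (t.-1)) < N)%N.
    by rewrite ltnNge; apply/negP => /t_min; lia.
  have : (t * t <= 4 * (t.-1 * t.-1))%N by nia.
  move=> /(leq_mul (leqnn r)) /leq_trans; apply.
  by rewrite mulnCA leq_mul2l (ltnW lt).
have k2 : (k * N * (k * N) <= 6 * n * t * (6 * n * t))%N by exact: leq_mul.
have k3 : (N * (k * k * N * r) <= N * (144 * (n * n)))%N.
  have := leq_mul k2 (leqnn r); have := leq_mul (leqnn (36 * (n * n))%N) rt; lia.
rewrite leq_pmul2l // in k3.
apply: (@leq_trans (24 * 288 * n ^ 2)%N); last by rewrite leq_mul2r orbT.
have -> : (N * k ^ 3 = k * (k * k * N))%N by ring.
rewrite -mulnn; have := leq_mul rk (leqnn (k * k * N)%N); lia.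
Qed.

Lemma rich_line_incidences :
  (k ^ 2 * \sum_(l : L) #|line_points l| <= 13 * (24 * 576) * #|P| ^ 2)%N.
Proof.
have := card_rich_lines; set n := #|P|; set N := #|` L| => Nk.
(* [m] is about [n / k^2]; the incidence bound is taken with [r = k] and [t = 118 * m], where
   [118 ^ 2 >= 24 * 576] makes [t] large enough. *)
pose m := (n %/ (k * k)).+1.
have kk0 : (0 < k * k)%N by rewrite muln_gt0; lia.
have nm : (n <= k * k * m)%N.
  by move: (divn_eq n (k * k)) (ltn_pmod n kk0); rewrite /m; lia.
have mn : (k * k * m <= n + k * k)%N by have := leq_divM n (k * k); rewrite /m; lia.
have Nt : (N <= k * (118 * m * (118 * m)))%N.
  rewrite -(@leq_pmul2r (k ^ 3)%N); last by rewrite expn_gt0; lia.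
  apply: leq_trans Nk _; rewrite -mulnn.
  apply: (@leq_trans (24 * 576 * (k * k * m * (k * k * m)))%N).
    by rewrite leq_mul2l leq_mul.
  have -> : (k * (118 * m * (118 * m)) * k ^ 3 =
     118 * 118 * (k * k * m * (k * k * m)))%N by ring.
  by rewrite leq_mul2r orbT.
have := line_incidences (ltnW k_ge2) (isT : 0 < 118 * m)%N Nt.
rewrite -/n -/N => /(leq_mul (leqnn (k ^ 2)%N)) h; apply: leq_trans h _.
have h1 := leq_mul (leqnn n) mn; have h2 := leq_mul (leqnn n) k_small.
have -> : (k ^ 2 * (12 * (N * k) + 3 * (n * (118 * m))) =
  12 * (N * k ^ 3) + 354 * (n * (k * k * m)))%N by ring.
by rewrite -mulnn in Nk *; rewrite -/n in h2; lia.
Qed.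

End Lines.

(** * Hyperbolas with given asymptotes *)

Lemma root_seq (R : realType) (p : {poly R}) : p != 0 ->
  exists2 rs : seq R, (size rs < size p)%N & forall x, root p x -> x \in rs.
Proof.
move en : (size p) => n; elim: n p en => [|n IH] p en p0.
  by move: p0; rewrite -size_poly_eq0 en.
have [[x px]|nox] := pselect (exists x, root p x); last first.
  by exists [::] => // x px; case: nox; exists x.
have /factor_theorem[q pq] := px.
have q0 : q != 0 by apply: contraNneq p0 => q0; rewrite pq q0 mul0r.
have qn : size q = n.
  by move: en; rewrite pq size_Mmonic ?monicXsubC // size_XsubC addn2 => -[].
have [rs rsn rsP] := IH q qn q0.
exists (x :: rs) => // y; rewrite pq rootM root_XsubC inE => /orP[/rsP->|->//].
by rewrite orbT.
Qed.

Definition height (R : realType) (l : R * R) (x y : R) := y - (l.1 * x + l.2).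

(* The branch, above both asymptotes [l] and [m], of the hyperbola that is the
   locus of the points spanning with [l] and [m] a parallelogram of area 2. *)
Definition branch (R : realType) (l m : R * R) (x : R) : R :=
  (((l.1 + m.1) * x + (l.2 + m.2)) +
   Num.sqrt (((m.1 - l.1) * x + (m.2 - l.2)) ^+ 2 + 8 * (m.1 - l.1))) / 2.

(** The last clause makes [t] the slope of the branch at [(x, y)]: differentiate the equation
    stating that [height l * height m] is constant. *)
Definition tangent (R : realType) (l m : R * R) (x y t : R) :=
  [&& l.1 < m.1, 0 < height l x y, 0 < height m x y,
      height l x y * height m x y == 2 * (m.1 - l.1)
    & t * (height l x y + height m x y) == l.1 * height m x y + m.1 * height l x y].

Section Branch.
Variable R : realType.
Implicit Types (l m : R * R) (x y t : R).

Lemma branch_continuous l m : continuous (branch l m).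
Proof.
have caff (a b : R) : continuous (fun x : R => a * x + b) by exact: affine_continuous.
have csq : continuous (fun x : R =>
    ((m.1 - l.1) * x + (m.2 - l.2)) ^+ 2 + 8 * (m.1 - l.1)).
  move=> x.
  have h := continuousM (caff (m.1 - l.1) (m.2 - l.2) x) (caff (m.1 - l.1) (m.2 - l.2) x).
  exact: (continuousD h (@cst_continuous _ _ (8 * (m.1 - l.1)) x)).
have crt : continuous (fun x : R =>
    Num.sqrt (((m.1 - l.1) * x + (m.2 - l.2)) ^+ 2 + 8 * (m.1 - l.1))).
  move=> x; exact: (continuous_comp (csq x) (@sqrt_continuous R _)).
move=> x; have h := continuousD (caff (l.1 + m.1) (l.2 + m.2) x) (crt x).
exact: (continuousM h (@cst_continuous _ _ (2^-1 : R) x)).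
Qed.

Lemma branch_spec l m x : l.1 < m.1 ->
  let y := branch l m x in
  [/\ 0 < height l x y, 0 < height m x y
    & height l x y * height m x y = 2 * (m.1 - l.1)].
Proof.
move=> lm y; rewrite /height /y /branch.
set u := (m.1 - l.1) * x + (m.2 - l.2).
set s := Num.sqrt _.
have s0 : 0 <= s by exact: sqrtr_ge0.
have s2 : s ^+ 2 = u ^+ 2 + 8 * (m.1 - l.1).
  by rewrite sqr_sqrtr // addr_ge0 ?sqr_ge0 //; lra.
have us : u < s by nra.
have us' : - u < s by nra.
have e1 : ((l.1 + m.1) * x + (l.2 + m.2) + s) / 2 - (l.1 * x + l.2) = (u + s) / 2.
  by rewrite /u; lra.
have e2 : ((l.1 + m.1) * x + (l.2 + m.2) + s) / 2 - (m.1 * x + m.2) = (s - u) / 2.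
  by rewrite /u; lra.
rewrite e1 e2; split; [lra|lra|].
have -> : (u + s) / 2 * ((s - u) / 2) = (s ^+ 2 - u ^+ 2) / 4 by field.
by rewrite s2; lra.
Qed.

Lemma branch_uniq l m x y :
  0 < height l x y -> 0 < height m x y ->
  height l x y * height m x y = 2 * (m.1 - l.1) -> branch l m x = y.
Proof.
move=> h1 h2 h12; rewrite /branch.
have -> : ((m.1 - l.1) * x + (m.2 - l.2)) ^+ 2 + 8 * (m.1 - l.1) =
    (height l x y + height m x y) ^+ 2.
  have -> : 8 * (m.1 - l.1) = 4 * (height l x y * height m x y) by rewrite h12; lra.
  by rewrite /height; ring.
rewrite sqrtr_sqr ger0_norm; last by rewrite addr_ge0 ?ltW.
by rewrite /height; field.
Qed.

(* In the asymptotic parametrisation of one branch the equation of the other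
   becomes a quartic in the height above [l]. *)
Lemma branch_crossings l m l' m' : l.1 < m.1 -> l'.1 < m'.1 -> (l, m) <> (l', m') ->
  exists2 zs : seq R, (size zs <= 4)%N &
    forall z, branch l m z = branch l' m' z -> z \in zs.
Proof.
move=> lm lm' ne.
pose d := m.1 - l.1; have d0 : d != 0 by rewrite /d; lra.
pose c := 2 * d; have c0 : c != 0 by rewrite mulf_neq0 // pnatr_eq0.
pose c' := 2 * (m'.1 - l'.1).
(* [height l' = p * height l + q * height m + e], and likewise for [m'] with primed coefficients;
   putting [height m = c / height l] turns the equation of the second branch into [Q]. *)
pose q := (l'.1 - l.1) / d; pose p := (m.1 - l'.1) / d.
pose q' := (m'.1 - l.1) / d; pose p' := (m.1 - m'.1) / d.
pose e := p * l.2 + q * m.2 - l'.2; pose e' := p' * l.2 + q' * m.2 - m'.2.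
pose Q := Poly [:: c ^+ 2 * (q * q'); c * (q * e' + q' * e);
  c * (p * q' + p' * q) + e * e' - c'; p * e' + p' * e; p * p'].
have pq1 : p + q = 1 by rewrite /p /q /d; field.
have pq1' : p' + q' = 1 by rewrite /p' /q' /d; field.
(* If [Q] were zero, the slopes of [l'] and [m'] would be those of [l] and [m]: either crosswise,
   against [l'.1 < m'.1], or in order, and then the intercepts agree too. *)
have Q0 : Q != 0.
  apply/eqP => /polyP Q0.
  have a4 : p * p' = 0 by have := Q0 4; rewrite coef0 coef_Poly.
  have a3 : p * e' + p' * e = 0 by have := Q0 3; rewrite coef0 coef_Poly.
  have a1 : c * (q * e' + q' * e) = 0 by have := Q0 1%N; rewrite coef0 coef_Poly.
  have a0 : c ^+ 2 * (q * q') = 0 by have := Q0 0; rewrite coef0 coef_Poly.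
  have qq : q * q' = 0.
    by move/eqP: a0; rewrite mulf_eq0 sqrf_eq0 (negPf c0) => /eqP.
  have a1' : q * e' + q' * e = 0.
    by move/eqP: a1; rewrite mulf_eq0 (negPf c0) => /eqP.
  have pd : p * d = m.1 - l'.1 by rewrite /p mulfVK.
  have pd' : p' * d = m.1 - m'.1 by rewrite /p' mulfVK.
  have qd : q * d = l'.1 - l.1 by rewrite /q mulfVK.
  move/eqP: a4; rewrite mulf_eq0 => /orP[] /eqP z.
    have q1 : q = 1 by lra.
    have q0' : q' = 0 by move: qq; rewrite q1 mul1r.
    have p1' : p' = 1 by lra.
    by move: pd pd'; rewrite z p1' /d; lra.
  have q1' : q' = 1 by lra.
  have q0 : q = 0 by move: qq; rewrite q1' mulr1.
  have p1 : p = 1 by lra.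
  move: a3 a1'; rewrite z q0 p1 q1' !mul1r !mul0r addr0 add0r => e0' e0.
  apply: ne; rewrite (surjective_pairing l) (surjective_pairing m)
    (surjective_pairing l') (surjective_pairing m').
  move: pd pd' e0 e0'; rewrite /e /e' z q0 p1 q1' /d => h1 h2 h3 h4.
  by congr ((_, _), (_, _)); lra.
have [rs rs5 rsP] := root_seq Q0.
exists [seq (tau - c / tau - (m.2 - l.2)) / d | tau <- rs].
  rewrite size_map -ltnS; apply: leq_trans rs5 _.
  exact: leq_trans (size_Poly _) _.
move=> z zz; have := branch_spec z lm; have := branch_spec z lm'.
rewrite /= -zz; set y := branch l m z => -[_ _ h'] [h1 h2 h].
apply/mapP; exists (height l z y).
  apply: rsP; rewrite /root horner_Poly /= mul0r !add0r.
  have h2E : height m z y = c / height l z y.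
    by rewrite /c /d -h mulrAC mulfV ?mul1r // gt_eqF.
  have k1 : height l' z y = p * height l z y + q * height m z y + e.
    by rewrite /e /height /p /q /d; field.
  have k2 : height m' z y = p' * height l z y + q' * height m z y + e'.
    by rewrite /e' /height /p' /q' /d; field.
  move: h'; rewrite k1 k2 -/c' h2E; set tau := height l z y in h1 *.
  have tau0 : tau != 0 by rewrite gt_eqF.
  move=> h'; apply/eqP; rewrite -h'; field.
  exact: tau0.
apply: (mulIf d0); rewrite mulfVK //.
have -> : c / height l z y = height m z y.
  by rewrite /c /d -h mulrAC mulfV ?mul1r // gt_eqF.
by rewrite /height /d; ring.
Qed.

Lemma tangent_on l m x y t : tangent l m x y t -> branch l m x = y.
Proof. by case/and5P => _ h1 h2 /eqP h _; exact: branch_uniq. Qed.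

Lemma tangent_slope l m x y t t' :
  tangent l m x y t -> tangent l m x y t' -> t = t'.
Proof.
case/and5P => _ h1 h2 _ /eqP e; case/and5P => _ _ _ _ /eqP e'.
have h0 : height l x y + height m x y != 0 by rewrite gt_eqF // addr_gt0.
by apply: (mulIf h0); rewrite e e'.
Qed.

(** Injectivity of [(a - 1)^3 / (a * (a + 1))] for positive [a], in polynomial form: the difference
    of the two sides is [a - b] times the positive sum [G]. *)
Lemma ratio_inj (a b : R) : 0 < a -> 0 < b -> a != 1 ->
  (a - 1) ^+ 3 * (b * (b + 1)) = (b - 1) ^+ 3 * (a * (a + 1)) -> a = b.
Proof.
move=> a0 b0 a1 e; apply/eqP; rewrite -subr_eq0.
pose G := (a * b - 1) ^+ 2 + a * (b - 1) ^+ 2 + b * (a - 1) ^+ 2.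
have G0 : G != 0.
  rewrite gt_eqF // ltr_wpDl ?addr_ge0 ?sqr_ge0 //.
    by rewrite mulr_ge0 ?sqr_ge0 // ltW.
  by rewrite mulr_gt0 // exprn_even_gt0 //= subr_eq0.
rewrite -(mulIr_eq0 _ (mulIf G0)); apply/eqP.
have -> : (a - b) * G =
  (a - 1) ^+ 3 * (b * (b + 1)) - (b - 1) ^+ 3 * (a * (a + 1)) by rewrite /G; ring.
by rewrite e subrr.
Qed.

(* [h] and [k] are the horizontal distances from the point of tangency to the
   triangle vertices lying on [l] and [m]. *)
Lemma tangent_param l m x y t : tangent l m x y t ->
  exists h k, [/\ 0 < h, 0 < k, height l x y = 2 / k, height m x y = 2 / h
    & l.1 = t - 2 / (k * (h + k)) /\ m.1 = t + 2 / (h * (h + k))].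
Proof.
case/and5P => lm; set f := height l x y; set f' := height m x y.
move=> f0 f0' /eqP ff /eqP ft; pose d := m.1 - l.1.
have d0 : 0 < d by rewrite /d; lra.
exists (f / d), (f' / d); split; rewrite ?divr_gt0 //.
- have -> : 2 = f * f' / d by rewrite ff -/d mulfK // gt_eqF.
  by field; rewrite !gt_eqF.
- have -> : 2 = f * f' / d by rewrite ff -/d mulfK // gt_eqF.
  by field; rewrite !gt_eqF.
have dE : d = f * f' / 2 by rewrite ff -/d; field.
have tE : t = (l.1 * f' + m.1 * f) / (f + f').
  by rewrite -ft mulfK // gt_eqF // addr_gt0.
have s0 : f + f' != 0 by rewrite gt_eqF // addr_gt0.
have g0 : f != 0 by rewrite gt_eqF.
have g0' : f' != 0 by rewrite gt_eqF.
have dn : d != 0 by rewrite gt_eqF.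
split.
  have -> : 2 / (f' / d * (f / d + f' / d)) = d * (2 * d / (f' * (f + f'))).
    by field; rewrite dn g0' s0.
  have -> : 2 * d / (f' * (f + f')) = f / (f + f') by rewrite dE; field; rewrite g0' s0.
  by rewrite tE /d; field.
have -> : 2 / (f / d * (f / d + f' / d)) = d * (2 * d / (f * (f + f'))).
  by field; rewrite dn g0 s0.
have -> : 2 * d / (f * (f + f')) = f' / (f + f') by rewrite dE; field; rewrite g0 s0.
by rewrite tE /d; field.
Qed.

(** [rho] is the ratio of the parameters [h] at the two points, while [h * k] is the same at both.
    Besides [rho], the last equation contains only data of the two flags. *)
Lemma tangent_pair l m x y t x' y' t' : x != x' ->
  tangent l m x y t -> tangent l m x' y' t' ->
  exists h k rho, [/\ [/\ 0 < h, 0 < k, 0 < rho & rho != 1],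
    [/\ height l x y = 2 / k, height m x y = 2 / h,
        l.1 = t - 2 / (k * (h + k)) & m.1 = t + 2 / (h * (h + k))],
    x' - x = (rho - 1) * (h + k / rho),
    (h + k) * (y' - y - t * (x' - x)) * rho = 2 * (rho - 1) ^+ 2 &
    t' != t /\ (y' - y - t * (x' - x)) * (y' - y - t' * (x' - x)) * (rho * (rho + 1))
      = - 2 * (rho - 1) ^+ 3 * (t' - t)].
Proof.
move=> xx' /tangent_param[h [k [h0 k0 hl hm [el em]]]].
move=> /tangent_param[h' [k' [h0' k0' hl' hm' [el' em']]]].
pose rho := h' / h; have rho0 : 0 < rho by rewrite divr_gt0.
have hn : h != 0 by rewrite gt_eqF.
have kn : k != 0 by rewrite gt_eqF.
have rn : rho != 0 by rewrite gt_eqF.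
have un : h + k != 0 by rewrite gt_eqF // addr_gt0.
have hn' : h' != 0 by rewrite gt_eqF.
have kn' : k' != 0 by rewrite gt_eqF.
have un' : h' + k' != 0 by rewrite gt_eqF // addr_gt0.
have h'E : h' = rho * h by rewrite /rho mulfVK.
have d1 : m.1 - l.1 = 2 / (h * k) by rewrite el em; field; rewrite hn kn un.
have d2 : m.1 - l.1 = 2 / (h' * k') by rewrite el' em'; field; rewrite hn' kn' un'.
have hk : h * k = h' * k'.
  have n2 : (2 : R) != 0 by rewrite pnatr_eq0.
  by move: d2; rewrite d1 => /(mulfI n2)/invr_inj.
have k'E : k' = k / rho.
  by apply: (mulfI hn'); rewrite -hk h'E; field.
have Dl : y' - y - l.1 * (x' - x) = 2 * (rho - 1) / k.
  have -> : 2 * (rho - 1) / k = 2 / k' - 2 / k by rewrite k'E; field; rewrite kn rn.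
  by rewrite -hl -hl' /height; ring.
have Dm : y' - y - m.1 * (x' - x) = 2 * (rho^-1 - 1) / h.
  have -> : 2 * (rho^-1 - 1) / h = 2 / h' - 2 / h by rewrite h'E; field; rewrite hn rn.
  by rewrite -hm -hm' /height; ring.
have Dx : x' - x = (rho - 1) * (h + k / rho).
  have n : m.1 - l.1 != 0 by rewrite d1 mulf_neq0 ?pnatr_eq0 // invr_eq0 mulf_neq0.
  apply: (mulfI n).
  have -> : (m.1 - l.1) * (x' - x) =
     (y' - y - l.1 * (x' - x)) - (y' - y - m.1 * (x' - x)) by ring.
  by rewrite Dl Dm d1; field; rewrite hn kn rn.
have r1 : rho != 1.
  by apply: contraNneq xx' => r1; rewrite -subr_eq0 -oppr_eq0 opprB Dx r1 subrr mul0r.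
have Dy : y' - y = 2 * (rho - 1) / k + l.1 * (x' - x) by rewrite -Dl; ring.
have u'n : rho * h + k / rho != 0 by rewrite -h'E -k'E.
have u'n' : rho * h * rho + k != 0.
  by rewrite gt_eqF //; apply: addr_gt0 => //; apply: mulr_gt0 => //; apply: mulr_gt0.
have E1 : y' - y - t * (x' - x) = 2 * (rho - 1) ^+ 2 / (rho * (h + k)).
  by rewrite Dy Dx el; field; rewrite kn rn un.
have tE : t' = l.1 + 2 / (k' * (h' + k')) by rewrite el'; ring.
have E2 : y' - y - t' * (x' - x) = - 2 * (rho - 1) ^+ 2 / (rho * (rho * h + k / rho)).
  rewrite Dy Dx tE h'E k'E; field.
  by rewrite ?kn ?rn ?un ?u'n ?u'n'.
have E3 : t' - t = 2 * (rho ^+ 2 - 1) / (rho * ((h + k) * (rho * h + k / rho))).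
  rewrite tE el h'E k'E; field.
  by rewrite ?kn ?rn ?un ?u'n ?u'n'.
exists h, k, rho; split => //.
  by rewrite E1; field; rewrite rn un.
split; last first.
  by rewrite E1 E2 E3; field; rewrite ?kn ?rn ?un ?u'n ?u'n'.
have r2 : rho ^+ 2 - 1 != 0.
  by rewrite subr_sqr_1 mulf_neq0 ?subr_eq0 // gt_eqF // addr_gt0.
have den : rho * ((h + k) * (rho * h + k / rho)) != 0.
  by apply: mulf_neq0 => //; apply: mulf_neq0.
by rewrite -subr_eq0 E3; apply: mulf_neq0; [apply: mulf_neq0|rewrite invr_eq0];
  rewrite ?pnatr_eq0.
Qed.

(** By [ratio_inj] and the last equation of [tangent_pair], the two flags determine [rho]; the other
    equations then give [h + k] and [h + k / rho], hence [h], [k] and both asymptotes. *)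
Lemma tangent_uniq l m l' m' x y t x' y' t' : x != x' ->
  tangent l m x y t -> tangent l m x' y' t' ->
  tangent l' m' x y t -> tangent l' m' x' y' t' -> l = l' /\ m = m'.
Proof.
move=> xx' T1 T2 T3 T4.
have [h [k [a [[h0 k0 a0 a1] [hl hm el em] Dx E [Z Q]]]]] := tangent_pair xx' T1 T2.
have [h' [k' [b [[h0' k0' b0 b1] [hl' hm' el' em'] Dx' E' [_ Q']]]]] :=
  tangent_pair xx' T3 T4.
have ab : a = b.
  apply: ratio_inj => //.
  have zn : - 2 * (t' - t) != 0 by rewrite mulf_neq0 ?subr_eq0 // oppr_eq0 pnatr_eq0.
  apply: (mulIf zn).
  transitivity ((- 2 * (a - 1) ^+ 3 * (t' - t)) * (b * (b + 1))); first by ring.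
  rewrite -Q mulrAC Q'; ring.
subst b.
have D0 : y' - y - t * (x' - x) != 0.
  apply: contra_neq a1 => D0; move: E; rewrite D0 mulr0 mul0r => /esym/eqP.
  by rewrite mulf_eq0 pnatr_eq0 sqrf_eq0 subr_eq0 => /eqP.
have an : a != 0 by rewrite gt_eqF.
have uu : h + k = h' + k'.
  by apply: (mulIf D0); apply: (mulIf an); rewrite E E'.
have a1' : a - 1 != 0 by rewrite subr_eq0.
have vv : h + k / a = h' + k' / a by apply: (mulfI a1'); rewrite -Dx -Dx'.
have kk : k = k'.
  have n : 1 - a^-1 != 0.
    by rewrite subr_eq0 -(inj_eq invr_inj) invr1 invrK eq_sym.
  by apply: (mulIf n); lra.
have hh : h = h' by lra.
subst h' k'.
have l1 : l.1 = l'.1 by rewrite el el'.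
have m1 : m.1 = m'.1 by rewrite em em'.
have l2 : l.2 = l'.2 by move: hl hl'; rewrite /height l1; lra.
have m2 : m.2 = m'.2 by move: hm hm'; rewrite /height m1; lra.
by rewrite (surjective_pairing l) (surjective_pairing m) l1 l2 m1 m2 -!surjective_pairing.
Qed.

End Branch.

(** * Triangles of area 1 *)

Lemma card_leq_rel (T U : finType) (A : {set T}) (B : {set U}) (Q : T -> U -> Prop) :
  (forall x, x \in A -> exists2 y, y \in B & Q x y) ->
  (forall x x' y, x \in A -> x' \in A -> Q x y -> Q x' y -> x = x') ->
  (#|A| <= #|B|)%N.
Proof.
move=> QE Qinj; have [->|[x0 x0A]] := set_0Vmem A; first by rewrite cards0.
have [y0 _ _] := QE _ x0A.
pose f x := if [pick y in B | `[< Q x y >]] is Some y then y else y0.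
have fP x : x \in A -> f x \in B /\ Q x (f x).
  move=> xA; rewrite /f; case: pickP => [y /andP[yB /asboolP qy]//|none].
  have [y yB qy] := QE _ xA; have := none y; rewrite /= yB /=.
  by move/asboolP.
rewrite -(@card_in_imset _ _ f A); last first.
  move=> x x' xA x'A e; have [_ q1] := fP _ xA; have [_ q2] := fP _ x'A.
  by apply: (Qinj x x' (f x)) => //; rewrite e.
by apply/subset_leq_card/subsetP => y /imsetP[x xA ->]; case: (fP _ xA).
Qed.

Section Triples.
Variables (R : realType) (P : finType) (X Y : P -> R).
Hypothesis X_inj : injective X.
Implicit Types a b c p q w : P.

(** Twice the signed area. *)
Definition cross p q w := (X q - X p) * (Y w - Y p) - (X w - X p) * (Y q - Y p).

Definition slope p q := (Y q - Y p) / (X q - X p).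

Definition parallel p q w : R * R := (slope p q, Y w - slope p q * X w).

Definition points_on (l : R * R) := [set p | on_line (X p) (Y p) l].

Lemma slopeM p q : p != q -> slope p q * (X q - X p) = Y q - Y p.
Proof. by move=> pq; rewrite /slope mulfVK // subr_eq0 (inj_eq X_inj) eq_sym. Qed.

(** For fixed [p] and [q] all admissible [w] lie on a single top line, and this line is poor. *)
Lemma card_poor_triples (v : R) (k : nat) :
  (#|[set x : P * P * P | [&& x.1.1 != x.1.2, cross x.1.1 x.1.2 x.2 == v
      & #|points_on (parallel x.1.1 x.1.2 x.2)| < k]]| <= #|P| ^ 2 * k)%N.
Proof.
rewrite -sum1dep_card -(pair_big_dep xpredT (fun pq w => [&& pq.1 != pq.2,
  cross pq.1 pq.2 w == v & (#|points_on (parallel pq.1 pq.2 w)| < k)%N])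
  (fun _ _ => 1%N)) /=.
rewrite -mulnn -card_prod -sum_nat_const; apply: leq_sum => -[p q] _ /=.
rewrite sum1dep_card; set W := [set w | _].
have [->|[w0]] := set_0Vmem W; first by rewrite cards0.
rewrite inE => /and3P[pq /eqP c0 lt]; apply: leq_trans (ltnW lt).
apply/subset_leq_card/subsetP => w; rewrite !inE => /and3P[_ /eqP cw _].
have n : X q - X p != 0 by rewrite subr_eq0 (inj_eq X_inj) eq_sym.
apply/eqP; apply: (mulIf n); move: c0 cw; rewrite /cross /= -(slopeM pq).
move: (slope p q) => s <-; lra.
Qed.

(* Triangles of area 1 whose middle vertex lies above the opposite side; it is
   this vertex whose parallel to the opposite side has the median slope, so that
   the hyperbola through it is the graph of a function. *)
Definition upper_triples := [set x : P * P * P |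
  [&& X x.1.1 < X x.1.2, X x.1.2 < X x.2 & cross x.1.1 x.1.2 x.2 == - 2]].

Definition rich_upper_triples (k : nat) := [set x in upper_triples |
  [&& (k <= #|points_on (parallel x.1.1 x.2 x.1.2)|)%N,
      (k <= #|points_on (parallel x.1.2 x.2 x.1.1)|)%N
    & (k <= #|points_on (parallel x.1.1 x.1.2 x.2)|)%N]].

Lemma lt_neq_point p q : X p < X q -> p != q.
Proof. by apply: contraTneq => ->; rewrite ltxx. Qed.

(** Outside the rich triples one of the three top lines is poor; permuting the vertices brings the
    triple to the form of [card_poor_triples], with [cross] equal to 2 or -2. *)
Lemma card_upper_triples (k : nat) :
  (#|upper_triples| <= #|rich_upper_triples k| + 3 * (#|P| ^ 2 * k))%N.
Proof.
pose poor v := [set x : P * P * P | [&& x.1.1 != x.1.2, cross x.1.1 x.1.2 x.2 == v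
      & (#|points_on (parallel x.1.1 x.1.2 x.2)| < k)%N]].
pose s1 (x : P * P * P) := (x.1.1, x.2, x.1.2).
pose s2 (x : P * P * P) := (x.1.2, x.2, x.1.1).
have s1_inj : injective s1 by move=> [[? ?] ?] [[? ?] ?] [-> -> ->].
have s2_inj : injective s2 by move=> [[? ?] ?] [[? ?] ?] [-> -> ->].
have sub : upper_triples \subset rich_upper_triples k :|:
    (s1 @^-1: poor 2 :|: (s2 @^-1: poor (-2) :|: poor (-2))).
  apply/subsetP => -[[a b] c] xT; have := xT.
  rewrite !inE /= => /and3P[ab bc /eqP cr]; rewrite ab bc cr eqxx /=.
  have cr1 : cross a c b == 2 by apply/eqP; move: cr; rewrite /cross; lra.
  have cr2 : cross b c a == - 2 by apply/eqP; move: cr; rewrite /cross; lra.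
  rewrite cr1 cr2 !lt_neq_point //=; last exact: lt_trans bc.
  by do 3![case: ltnP => ?]; rewrite ?orbT.
apply: leq_trans (subset_leq_card sub) _.
apply: leq_trans (leq_card_setU _ _) _; rewrite leq_add2l.
rewrite 2!mulSn mul1n.
apply: card_setU_leq; last apply: card_setU_leq.
- apply: leq_trans (card_poor_triples 2 k); rewrite card_preimset //.
- apply: leq_trans (card_poor_triples (-2) k); rewrite card_preimset //.
- exact: card_poor_triples.
Qed.

Lemma upper_slopes a b c : X a < X b -> X b < X c -> cross a b c = - 2 ->
  (X b - X a) * ((X c - X b) * (slope a b - slope b c)) = 2 /\ slope b c < slope a b.
Proof.
move=> ab bc cr.
have e : (X b - X a) * ((X c - X b) * (slope a b - slope b c)) = 2.
  have e1 := slopeM (lt_neq_point ab); have e2 := slopeM (lt_neq_point bc).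
  have -> : (X b - X a) * ((X c - X b) * (slope a b - slope b c)) =
    (X c - X b) * (slope a b * (X b - X a)) -
    (X b - X a) * (slope b c * (X c - X b)) by ring.
  by rewrite e1 e2; move: cr; rewrite /cross; lra.
split => //; rewrite -subr_gt0.
have p1 : 0 < X b - X a by lra.
have p2 : 0 < X c - X b by lra.
by rewrite -(pmulr_rgt0 _ p2) -(pmulr_rgt0 _ p1) e; lra.
Qed.

(** The heights of [b] over the top lines at [a] and [c] are [slope a b - slope b c] times the
    horizontal distances from [b] to [a] and to [c]; [slope a c] is the mean of [slope a b] and
    [slope b c] with these distances as weights. *)
Lemma upper_tangent a b c : X a < X b -> X b < X c -> cross a b c = - 2 ->
  tangent (parallel b c a) (parallel a b c) (X b) (Y b) (slope a c).
Proof.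
move=> ab bc cr; have [e lt] := upper_slopes ab bc cr.
have ac := lt_trans ab bc.
have eab := slopeM (lt_neq_point ab); have ebc := slopeM (lt_neq_point bc).
have eac := slopeM (lt_neq_point ac).
have h1 : height (parallel b c a) (X b) (Y b) =
    (X b - X a) * (slope a b - slope b c).
  rewrite /height /=; have -> : Y b = Y a + slope a b * (X b - X a) by lra.
  by ring.
have h2 : height (parallel a b c) (X b) (Y b) =
    (X c - X b) * (slope a b - slope b c).
  rewrite /height /=; have -> : Y c = Y b + slope b c * (X c - X b) by lra.
  by ring.
have p1 : 0 < X b - X a by lra.
have p2 : 0 < X c - X b by lra.
have p3 : 0 < slope a b - slope b c by lra.
rewrite /tangent h1 h2 /= lt !mulr_gt0 //=; apply/andP; split; apply/eqP.
  by rewrite -[in RHS]e; ring.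
have n : X c - X a != 0 by lra.
have -> : slope a c = (slope a b * (X b - X a) + slope b c * (X c - X b)) / (X c - X a).
  by rewrite eab ebc; apply: (mulIf n); rewrite eac mulfVK //; lra.
by field.
Qed.

Variable k : nat.

Definition rich_lines : {fset R * R} :=
  [fset l in [seq parallel x.1.1 x.1.2 x.2 | x <- enum {: P * P * P}]
    | (k <= #|points_on l|)%N]%fset.

Lemma rich_lines_in p q w : (k <= #|points_on (parallel p q w)|)%N ->
  parallel p q w \in rich_lines.
Proof.
move=> h; rewrite !inE /= h andbT; apply/mapP; exists (p, q, w) => //.
by rewrite mem_enum.
Qed.

Let L := rich_lines.

Lemma rich_linesP (l : L) : (k <= #|line_points X Y l|)%N.
Proof. by have := valP l; rewrite !inE /= => /andP[]. Qed.

Definition flag := {x : P * L | x.1 \in line_points X Y x.2}.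
Definition asymptotes := {x : L * L | (val x.1).1 < (val x.2).1}.

Lemma card_flag : #|{: flag}| = (\sum_(l : L) #|line_points X Y l|)%N.
Proof.
rewrite card_sig -sum1_card.
rewrite (eq_bigr (fun l => \sum_(p in line_points X Y l) 1)%N); last first.
  by move=> l _; rewrite sum1_card.
rewrite (exchange_big_dep xpredT) //= pair_big_dep /=.
by apply: eq_bigl => x; rewrite inE.
Qed.

Lemma card_asymptotes : (#|{: asymptotes}| <= #|` L| ^ 2)%N.
Proof. by rewrite card_sig -mulnn cardfE -card_prod max_card. Qed.

(** A triple [(a, b, c)] goes to the hyperbola with the top lines at [a] and [c] as asymptotes and
    to the flag of [b] with its top line. Two branches meet at most 4 times, whence
    [48 = 12 * 4]. *)
Lemma card_rich_upper_triples (r t : nat) :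
  (0 < r -> 0 < t -> #|` L| ^ 2 <= r * (t * t) ->
   #|rich_upper_triples k| <=
     48 * (#|` L| ^ 2 * r) + 3 * ((\sum_(l : L) #|line_points X Y l|) * t))%N.
Proof.
move=> r0 t0 Lrt; rewrite -card_flag.
pose inc (f : flag) (j : asymptotes) :=
  tangent (val (val j).1) (val (val j).2) (X (val f).1) (Y (val f).1)
    (val (val f).2).1.
have inc_px f f' j : inc f j -> inc f' j -> X (val f).1 = X (val f').1 -> f = f'.
  move=> i i' /X_inj e; move: i i'; rewrite /inc -e => i i'.
  have s := tangent_slope i i'.
  apply/val_inj; rewrite (surjective_pairing (val f)) (surjective_pairing (val f')).
  rewrite e; congr pair; apply/val_inj.
  have o : (val f).1 \in line_points X Y (val f).2 := valP f.
  have o' : (val f').1 \in line_points X Y (val f').2 := valP f'.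
  move: o o'; rewrite !inE -e => /eqP o /eqP o'.
  move: o o' s; move: (val (val f).2) (val (val f').2) => [s1 u1] [s2 u2] /= o o' s.
  by congr pair => //; move: o o'; rewrite s; lra.
have W : (\sum_j #|[set f | inc f j]| <=
    12 * 4 * (#|{: asymptotes}| * r) + 3 * (#|{: flag}| * t))%N.
  apply: (@incidence_bound R asymptotes flag
    (fun j => branch (val (val j).1) (val (val j).2))
    (fun f => X (val f).1) (fun f => Y (val f).1) inc 4) => //.
  - by move=> j; exact: branch_continuous.
  - by move=> f j /tangent_on.
  - move=> f f' j j' i1 i2 i3 i4 ff'.
    have xx : X (val f).1 != X (val f').1.
      by apply: contraNneq ff' => e; rewrite (inc_px f f' j).
    have [e1 e2] := tangent_uniq xx i1 i2 i3 i4.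
    apply/val_inj; rewrite (surjective_pairing (val j)) (surjective_pairing (val j')).
    by congr pair; apply/val_inj.
  - move=> j j' ne; apply: branch_crossings; [exact: (valP j)|exact: (valP j')|].
    move=> [e1 e2]; case/eqP: ne; apply/val_inj.
    rewrite (surjective_pairing (val j)) (surjective_pairing (val j')).
    by congr pair; apply/val_inj.
  - exact: leq_trans card_asymptotes Lrt.
apply: (@leq_trans (\sum_j #|[set f | inc f j]|)); last first.
  apply: leq_trans W _; rewrite leq_add2r leq_mul2l leq_mul2r card_asymptotes.
  by rewrite orbT.
have -> : (\sum_j #|[set f | inc f j]| =
    #|[set x : asymptotes * flag | inc x.2 x.1]|)%N.
  under eq_bigr do rewrite -sum1dep_card.
  by rewrite pair_big_dep /= -sum1dep_card.
pose Q (x : P * P * P) (y : asymptotes * flag) :=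
  [/\ (val y.2).1 = x.1.2, val (val y.2).2 = parallel x.1.1 x.2 x.1.2,
      val (val y.1).1 = parallel x.1.2 x.2 x.1.1
    & val (val y.1).2 = parallel x.1.1 x.1.2 x.2].
apply: (@card_leq_rel _ _ _ _ Q).
  move=> [[a b] c]; rewrite !inE /= => /and4P[/and3P[ab bc /eqP cr] k1 k2 k3].
  have T := upper_tangent ab bc cr; have [_ lt] := upper_slopes ab bc cr.
  pose l1 : L := [` rich_lines_in k1]%fset; pose l2 : L := [` rich_lines_in k2]%fset.
  pose l3 : L := [` rich_lines_in k3]%fset.
  have fP : (b, l1).1 \in line_points X Y (b, l1).2.
    by rewrite inE /on_line /= addrC subrK.
  have jP : (val (l2, l3).1).1 < (val (l2, l3).2).1 by [].
  by exists (exist _ (l2, l3) jP, exist _ (b, l1) fP) => //=; rewrite inE.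
move=> [[a b] c] [[a' b'] c'] y; rewrite !inE /=.
move=> /andP[/and3P[ab bc /eqP cr] _] /andP[/and3P[ab' bc' /eqP cr'] _].
case=> /= e1 _ e3 e4 [] /= e1' _; rewrite e3 e4 => -[s1 u1] [s2 u2].
have {e1 e1'} bb : b' = b by rewrite -e1 -e1'.
subst b'; have [_ lt] := upper_slopes ab bc cr.
have m1 := slopeM (lt_neq_point ab); have m1' := slopeM (lt_neq_point ab').
have m2 := slopeM (lt_neq_point bc); have m2' := slopeM (lt_neq_point bc').
(* [a] is the intersection of the first asymptote with the line through [b] parallel to the second,
   and [c] symmetrically; the slopes differ, so both are determined. *)
have n : slope a b - slope b c != 0 by lra.
have -> : a' = a.
  by apply/X_inj/(mulfI n); move: m1' u1; rewrite -s1 -s2; lra.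
have -> // : c' = c.
  by apply/X_inj/(mulfI n); move: m2' u2; rewrite -s1 -s2; lra.
Qed.

End Triples.

(** * Choice of the parameters *)

(** Up to constants [l] is at most [n^2 / k^3] and [f] at most [n^2 / k^2]. With [r] about
    [k^7 / n^2] and [t] about [k^3] both terms become [n^2 * k], and [l^2 <= r * t^2] becomes
    [n^6 <= k^19], the source of the exponent 6/19. *)
Lemma balance_parameters (C1 C2 n k l f : nat) :
  (0 < n -> 0 < k -> n ^ 6 <= k ^ 19 -> l * k ^ 3 <= C1 * n ^ 2 ->
   k ^ 2 * f <= C2 * n ^ 2 -> 0 < C1 ->
   exists r t, [/\ 0 < r, 0 < t, l ^ 2 <= r * (t * t),
     l ^ 2 * r <= 2 * C1 ^ 2 * (n ^ 2 * k) & f * t <= C1 * C2 * (n ^ 2 * k)])%N.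
Proof.
move=> n0 k0 nk lk kf C10.
have n2k7 : (n ^ 2 <= k ^ 7)%N.
  rewrite -(@leq_exp2r _ _ 3) // -!expnM; apply: leq_trans nk _.
  by rewrite leq_pexp2l.
have n20 : (0 < n ^ 2)%N by rewrite expn_gt0 n0.
have kp i : (0 < k ^ i)%N by rewrite expn_gt0 k0.
pose r := (k ^ 7 %/ n ^ 2).+1; exists r, (C1 * k ^ 3)%N.
have rn : (k ^ 7 <= r * n ^ 2)%N by rewrite ltnW // /r ltn_ceil.
have nr : (r * n ^ 2 <= 2 * k ^ 7)%N.
  by rewrite /r mulSn mul2n -addnn leq_add // leq_divM.
have l2 : (l ^ 2 * k ^ 6 <= C1 ^ 2 * n ^ 4)%N.
  have := leq_mul lk lk.
  have -> : (l * k ^ 3 * (l * k ^ 3) = l ^ 2 * k ^ 6)%N by ring.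
  by have -> : (C1 * n ^ 2 * (C1 * n ^ 2) = C1 ^ 2 * n ^ 4)%N by ring.
split => //; first by rewrite muln_gt0 C10 kp.
- have n4 : (n ^ 4 <= r * k ^ 12)%N.
    rewrite -(leq_pmul2r n20) -expnD; apply: leq_trans nk _.
    have -> : (r * k ^ 12 * n ^ 2 = (r * n ^ 2) * k ^ 12)%N by ring.
    by rewrite (_ : 19%N = 7 + 12)%N // expnD leq_mul2r rn orbT.
  rewrite -(leq_pmul2r (kp 6)); apply: leq_trans l2 _.
  have -> : (r * (C1 * k ^ 3 * (C1 * k ^ 3)) * k ^ 6 = C1 ^ 2 * (r * k ^ 12))%N by ring.
  by rewrite leq_mul2l n4 orbT.
- rewrite -(leq_pmul2r (kp 6)).
  have -> : (l ^ 2 * r * k ^ 6 = l ^ 2 * k ^ 6 * r)%N by ring.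
  apply: (@leq_trans (C1 ^ 2 * n ^ 4 * r)); first by rewrite leq_mul2r l2 orbT.
  have -> : (C1 ^ 2 * n ^ 4 * r = C1 ^ 2 * n ^ 2 * (r * n ^ 2))%N by ring.
  have -> : (2 * C1 ^ 2 * (n ^ 2 * k) * k ^ 6 = C1 ^ 2 * n ^ 2 * (2 * k ^ 7))%N by ring.
  by rewrite leq_mul2l nr orbT.
have -> : (f * (C1 * k ^ 3) = C1 * k * (k ^ 2 * f))%N by ring.
have -> : (C1 * C2 * (n ^ 2 * k) = C1 * k * (C2 * n ^ 2))%N by ring.
by rewrite leq_mul2l kf orbT.
Qed.

Lemma upper_triples_leq : exists K : nat, forall (R : realType) (P : finType)
    (X Y : P -> R) (k : nat), injective X -> (2 <= k -> k * k <= 4 * #|P| ->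
  #|P| ^ 6 <= k ^ 19 -> #|upper_triples X Y| <= K * (#|P| ^ 2 * k))%N.
Proof.
pose C1 := (24 * 576)%N; pose C2 := (13 * (24 * 576))%N.
(* The three summands pay for the poor triples, for the term in the number of hyperbolas
   ([96 = 48 * 2]) and for the term in the number of flags. *)
exists (3 + 96 * C1 ^ 2 + 3 * (C1 * C2))%N => R P X Y k X_inj k2 kk nk.
have h1 := card_rich_lines X_inj k2 (@rich_linesP _ _ X Y k) kk.
have h2 := rich_line_incidences X_inj k2 (@rich_linesP _ _ X Y k) kk.
have C10 : (0 < C1)%N by [].
rewrite -/C1 in h1; rewrite -/C2 in h2.
have h3 := @card_rich_upper_triples R P X Y X_inj k.
have h4 := card_upper_triples Y X_inj k.
move: C1 C2 h1 h2 C10 => C1 C2 h1 h2 C10.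
have n0 : (0 < #|P|)%N by move: kk k2; case: #|P| => // ; nia.
have [r [t [r0 t0 lrt lr ft]]] :=
  balance_parameters n0 (ltnW k2) nk h1 h2 C10.
have h5 := h3 r t r0 t0 lrt; apply: leq_trans h4 _.
have e : ((3 + 96 * C1 ^ 2 + 3 * (C1 * C2)) * (#|P| ^ 2 * k) =
  48 * (2 * C1 ^ 2 * (#|P| ^ 2 * k)) + 3 * (C1 * C2 * (#|P| ^ 2 * k)) +
  3 * (#|P| ^ 2 * k))%N by ring.
rewrite e leq_add2r; apply: leq_trans h5 _.
by apply: leq_add; rewrite leq_mul2l ?lr ?ft orbT.
Qed.

(** Take [n^(6/19)] rounded up. Since [12 <= 19], its predecessor satisfies [k.-1 ^ 12 <= n ^ 6],
    whence [k * k <= 4 * n]. *)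
Lemma cutoff_ex (n : nat) : (3 <= n)%N -> exists k : nat,
  [/\ (2 <= k)%N, (k * k <= 4 * n)%N, (n ^ 6 <= k ^ 19)%N & (k.-1 ^ 19 <= n ^ 6)%N].
Proof.
move=> n3; have ex : exists k, (n ^ 6 <= k ^ 19)%N.
  by exists n; rewrite leq_pexp2l //; lia.
case: (ex_minnP ex) => k nk k_min; exists k.
have k2 : (2 <= k)%N.
  rewrite ltnNge; apply/negP => k1; have : (n ^ 6 <= 1 ^ 19)%N.
    by apply: leq_trans nk _; rewrite leq_exp2r.
  have : (n ^ 1 <= n ^ 6)%N by rewrite leq_pexp2l //; lia.
  by rewrite exp1n expn1 => /leq_trans h /h; lia.
have kn : (k.-1 ^ 19 < n ^ 6)%N by rewrite ltnNge; apply/negP => /k_min; lia.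
split => //; last exact: ltnW.
have k1n : (k.-1 ^ 2 <= n)%N.
  rewrite -(@leq_exp2r _ _ 6) // -expnM; apply: leq_trans (ltnW kn).
  by rewrite leq_pexp2l //; lia.
by move: k1n; rewrite -mulnn; nia.
Qed.

Lemma cutoff_powR (R : realType) (n k : nat) : (3 <= n)%N -> (2 <= k)%N ->
  (k.-1 ^ 19 <= n ^ 6)%N ->
  (n ^ 2 * k)%:R <= 2 * (n%:R `^ (44%:R / 19%:R)) :> R.
Proof.
move=> n3 k2 kn.
have n0 : (0 : R) < n%:R by rewrite ltr0n; lia.
have -> : (44%:R / 19%:R : R) = 2%:R + 6%:R / 19%:R by field.
rewrite powRD; last by rewrite (gt_eqF n0) implybT.
rewrite (powR_mulrn _ (ltW n0)); set w := n%:R `^ (6%:R / 19%:R).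
have w0 : 0 <= w by exact: powR_ge0.
have w19 : w ^+ 19 = n%:R ^+ 6.
  rewrite -powR_mulrn // /w -powRrM.
  have -> : (6%:R / 19%:R * 19%:R : R) = 6%:R by field.
  by rewrite powR_mulrn // ltW.
have kw : (k.-1)%:R <= w.
  by rewrite -(@ler_pXn2r _ 19) ?nnegrE // w19 -!natrX ler_nat.
have k2w : k%:R <= 2 * w.
  have : (k%:R : R) <= (2 * k.-1)%:R by rewrite ler_nat; lia.
  by rewrite natrM; lra.
have := ler_wpM2l (exprn_ge0 2 (ltW n0)) k2w.
by rewrite natrM natrX; lra.
Qed.

(** * From point sets to sorted triples with distinct abscissae *)

(** Each pair of points with distinct ordinates forbids one value of [th]; [th] is taken above all
    of them. *)
Lemma generic_shear (R : realType) (S : {fset R * R}) :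
  exists th : R, forall p q, p \in S -> q \in S ->
    p.1 + th * p.2 = q.1 + th * q.2 -> p = q.
Proof.
pose bad : seq R := [seq - (x.1.1 - x.2.1) / (x.1.2 - x.2.2) |
  x <- [seq (p, q) | p <- enum_fset S, q <- enum_fset S]].
pose th := \sum_(b <- bad) `|b| + 1; exists th => p q pS qS e.
have notbad b : b \in bad -> b < th.
  move=> bb; apply: le_lt_trans (ler_norm b) _; rewrite /th (big_rem b) //=.
  rewrite -addrA ltrDl; apply: lt_le_trans ltr01 _; rewrite lerDr.
  by apply: sumr_ge0.
have [e2|ne] := eqVneq p.2 q.2.
  by move: e; rewrite (surjective_pairing p) (surjective_pairing q) e2 /=
    => /addIr ->.
have n : p.2 - q.2 != 0 by rewrite subr_eq0.
have thE : th = - (p.1 - q.1) / (p.2 - q.2).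
  by apply: (mulIf n); rewrite mulfVK //; lra.
have /notbad : th \in bad.
  rewrite {1}thE; apply/mapP; exists (p, q) => //.
  by apply/allpairsP; exists (p, q).
by rewrite ltxx.
Qed.

Lemma sort_triangle (R : realType) (S : {fset R * R}) (X : S -> R) (Y : S -> R) :
  injective X -> forall p q r : S, p != q -> p != r -> q != r ->
  exists a b c : S, [/\ X a < X b, X b < X c,
    [fset val p; val q; val r] = [fset val a; val b; val c]
    & `|cross X Y a b c| = `|cross X Y p q r|].
Proof.
move=> X_inj p q r pq pr qr.
have flip (u v : R) : u = - v -> `|u| = `|v| by move=> ->; rewrite normrN.
have lt (u v : S) : u != v -> X u < X v \/ X v < X u.
  by rewrite -(inj_eq X_inj) neq_lt => /orP.
have fE (x y z x' y' z' : R * R) : [:: x; y; z] =i [:: x'; y'; z'] ->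
    [fset x; y; z] = [fset x'; y'; z'].
  move=> h; apply/fsetP => u; have := h u.
  by rewrite !inE -!orbA.
case: (lt _ _ pq) => h1; case: (lt _ _ pr) => h2; case: (lt _ _ qr) => h3; try lra.
- by exists p, q, r.
- exists p, r, q; split=> //; last by apply: flip; rewrite /cross; ring.
  by apply: fE => u; rewrite !inE; do !case: eqP.
- exists r, p, q; split=> //; last by congr `|_|; rewrite /cross; ring.
  by apply: fE => u; rewrite !inE; do !case: eqP.
- exists q, p, r; split=> //; last by apply: flip; rewrite /cross; ring.
  by apply: fE => u; rewrite !inE; do !case: eqP.
- exists q, r, p; split=> //; last by congr `|_|; rewrite /cross; ring.
  by apply: fE => u; rewrite !inE; do !case: eqP.
- exists r, q, p; split=> //; last by apply: flip; rewrite /cross; ring.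
  by apply: fE => u; rewrite !inE; do !case: eqP.
Qed.

Definition abscissa (R : realType) (S : {fset R * R}) (th : R) (p : S) : R :=
  (val p).1 + th * (val p).2.

Definition ordinate (R : realType) (S : {fset R * R}) (p : S) : R := (val p).2.

(** The shear preserves [cross] and sorting the vertices changes at most its sign, so [cross] is -2
    or 2; in the second case reflection in the horizontal axis gives an upper triple. *)
Lemma unit_area_triangles_leq (R : realType) (S : {fset R * R}) (th : R) :
  injective (@abscissa R S th) ->
  (#|` unit_area_triangles S| <= #|upper_triples (@abscissa R S th) (@ordinate R S)|
    + #|upper_triples (@abscissa R S th) (fun p => - ordinate p)|)%N.
Proof.
set X := @abscissa R S th; set Y := @ordinate R S => X_inj.
pose U := upper_triples X Y :|: upper_triples X (fun p => - Y p).
suff : (#|` unit_area_triangles S| <= #|U|)%N.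
  by move/leq_trans; apply; exact: leq_card_setU.
rewrite cardfE -cardsT.
pose Q (T : unit_area_triangles S) (x : S * S * S) :=
  val T = [fset val x.1.1; val x.1.2; val x.2].
apply: (@card_leq_rel _ _ _ _ Q); last first.
  by move=> T T' x _ _ q q'; apply/val_inj; rewrite q q'.
move=> T _; have := valP T; rewrite !inE /= => /andP[/andP[TS _] /asboolP].
case=> p [q [r [Te area]]].
have [pS qS rS] : [/\ p \in S, q \in S & r \in S].
  move: TS; rewrite fpowersetE Te => /fsubsetP h.
  by split; apply: h; rewrite !inE eqxx ?orbT.
pose p' := [` pS]; pose q' := [` qS]; pose r' := [` rS].
have cr : `|cross X Y p' q' r'| = 2.
  move: area; rewrite /triangle_area /cross /X /Y /abscissa /ordinate /=.
  have -> : (q.1 + th * q.2 - (p.1 + th * p.2)) * (r.2 - p.2) -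
    (r.1 + th * r.2 - (p.1 + th * p.2)) * (q.2 - p.2) =
    (q.1 - p.1) * (r.2 - p.2) - (r.1 - p.1) * (q.2 - p.2) by ring.
  by move=> h; lra.
have [pq pr qr] : [/\ p' != q', p' != r' & q' != r'].
  have nz (u : R) : u = 0 -> `|u| = 2 -> False by move=> ->; rewrite normr0; lra.
  by split; apply/eqP => e; apply: (nz _ _ cr); rewrite e /cross; ring.
have [a [b [c [ab bc fe ce]]]] := sort_triangle Y X_inj pq pr qr.
exists (a, b, c); last by rewrite /Q /= Te; exact: fe.
move: ce; rewrite cr !inE /= ab bc /= => ce; apply/orP.
have [h|h] := leP 0 (cross X Y a b c).
  right; rewrite ger0_norm // in ce; apply/eqP; move: ce; rewrite /cross; lra.
by left; rewrite ltr0_norm // in ce; apply/eqP; lra.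
Qed.

Theorem theorem1 (R : realType) :
  exists C : R, 0 < C /\
    forall (n : nat) (S : {fset R * R}), (3 <= n)%N -> #|` S| = n ->
      (#|` unit_area_triangles S|)%:R <= C * (n%:R `^ (44%:R / 19%:R)).
Proof.
have [K KP] := upper_triples_leq.
(* One factor 2 comes from the reflection, the other from [cutoff_powR]; [K.+1] keeps the constant
   positive. *)
exists (4 * K.+1%:R); split; first by rewrite mulr_gt0 // ltr0n.
move=> n S n3 Sn; have [k [k2 kk nk kn]] := cutoff_ex n3.
have [th thP] := generic_shear S.
have X_inj : injective (@abscissa R S th).
  by move=> p q e; apply/val_inj/thP => //; exact: valP.
have h := unit_area_triangles_leq X_inj.
have Sn' : #|{: S}| = n by rewrite -cardfE.
have h1 := KP R S _ (@ordinate R S) k X_inj.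
have h2 := KP R S _ (fun p => - ordinate p) k X_inj.
rewrite Sn' in h1 h2.
have {}h : (#|` unit_area_triangles S| <= 2 * K.+1 * (n ^ 2 * k))%N.
  apply: leq_trans h _; apply: leq_trans (leq_add (h1 k2 kk nk) (h2 k2 kk nk)) _.
  by rewrite -mulnDl leq_mul2r; apply/orP; right; lia.
have h3 := cutoff_powR R n3 k2 kn.
apply: (@le_trans _ _ (2 * K.+1 * (n ^ 2 * k))%:R); first by rewrite ler_nat.
have -> : 4 * K.+1%:R * n%:R `^ (44%:R / 19%:R) =
  (2 * K.+1)%:R * (2 * n%:R `^ (44%:R / 19%:R)) :> R by rewrite natrM; ring.
by rewrite natrM ler_wpM2l // ler0n.
Qed.
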